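(* Let $n\ge 1$ and let $d\ge 2$ be even. Let $\tilde{C}_{n,d}$ denote the set of convex polynomials, and $\tilde{\Sigma C}_{n,d}$ the set of sos-convex polynomials, in $n$ variables and of degree $d$. Then $\tilde{\Sigma C}_{n,d}=\tilde{C}_{n,d}$ if and only if $n=1$ or $d=2$ or $(n,d)=(2,4)$.
   Context: Polynomials have real coefficients, and ''of degree $d$'' is understood as degree at most $d$ (so that these sets are closed convex cones). A polynomial $p$ is convex if it is a convex function on $\mathbb{R}^n$ (equivalently its Hessian is positive semidefinite everywhere). A polynomial $p$ with Hessian $H(x)$ is sos-convex if $H(x)$ is an sos-matrix, i.e. $H(x)=V(x)^TV(x)$ for some (possibly rectangular) matrix $V(x)$ with real polynomial entries; equivalently, the polynomial $y^TH(x)y$ in the $2n$ variables $(x,y)$ is a sum of squares of real polynomials. *)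

(* Defs.v *)
From HB Require Import structures.
From mathcomp Require Import all_boot all_order all_algebra.
From mathcomp Require Import mpoly.
From mathcomp Require Import classical_sets reals convex.

Set Implicit Arguments.
Unset Strict Implicit.
Unset Printing Implicit Defensive.

Import Order.TTheory GRing.Theory Num.Theory.
Local Open Scope classical_set_scope.
Local Open Scope ring_scope.

Definition convex_poly (R : realType) (n : nat) (p : {mpoly R[n]}) : Prop :=
  convex_function [set: 'rV[R]_n] (fun x : 'rV[R]_n => p.@[x ord0]).

Definition hessian (R : realType) (n : nat) (p : {mpoly R[n]}) :
    'M[{mpoly R[n]}]_n :=
  \matrix_(i < n, j < n) p^`M(j)^`M(i).

Definition sos_matrix (R : realType) (n k : nat) (P : 'M[{mpoly R[n]}]_k) :
    Prop :=
  exists (m : nat) (V : 'M[{mpoly R[n]}]_(m, k)), P = V^T *m V.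

Definition sos_convex_poly (R : realType) (n : nat) (p : {mpoly R[n]}) : Prop :=
  sos_matrix (hessian p).

(* [msize p] is one more than the total degree of [p], and [msize 0 = 0]: the
   bound below means degree at most [d], the zero polynomial included. *)
Definition convex_polys (R : realType) (n d : nat) : set {mpoly R[n]} :=
  [set p | (msize p <= d.+1)%N /\ convex_poly p].

Definition sos_convex_polys (R : realType) (n d : nat) : set {mpoly R[n]} :=
  [set p | (msize p <= d.+1)%N /\ sos_convex_poly p].

Arguments convex_polys : clear implicits.
Arguments sos_convex_polys : clear implicits.

(* Main.v *)
Require Import Defs.
From mathcomp Require Import all_boot all_order all_algebra.
From mathcomp Require Import mpoly.
From mathcomp Require Import classical_sets reals convex.
From mathcomp Require Import boolp topology normedtype derive interval_inference.
From mathcomp Require Import polyrcf complex ring lra.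

(** The easy inclusion: along a line [x + t v] the second derivative of [p] is
    [v^T H(x + t v) v], so a polynomial is convex iff this form is nonnegative
    ([convex_polyP]), and [H = V^T V] makes it a sum of squares
    ([sos_convex_convex]).

    Equality in the three cases says that a positive semidefinite Hessian is
    automatically an sos-matrix.  For [n = 1] the Hessian is one nonnegative
    univariate polynomial, hence a sum of squares ([nonneg_poly_sos]).  For
    [d = 2] it is a constant positive semidefinite matrix.  For
    [(n, d) = (2, 4)] homogenizing the entries turns [v^T H(x) v] into a form
    that is quadratic in three variables and quadratic in the two variables
    [v], and every nonnegative form that is quadratic in any number of
    variables and quadratic in two others is a sum of squares of bilinear
    forms ([psd_pencil_sos]; its constant case also gives [d = 2]).
    That theorem is proved by descent on the number of variables.  Subtracting
    a multiple of [|x|^2 (s^2 + t^2)], itself a sum of squares, creates a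
    nontrivial zero, by compactness.  When the zero is [x0] for
    [(s, t) = (1, 0)], the image of [x0] under the matrix of the form in [x] is
    divisible by [t], so completing the square in the direction [x0] costs a
    single square of a bilinear form: the remainder is still biquadratic, still
    nonnegative, and no longer depends on the direction [x0]
    ([pencil_deflate], [kernel_compression]).

    Outside these cases the degree bound allows one of two explicit convex
    polynomials that are not sos-convex.  As degrees are bounded above and
    further variables may be absent, they settle all remaining [(n, d)]:
    - [2 x^6 + 2 y^6 + x^2 y^2 (x^2 + y^2) - (x^2 + y^2)^2 + x^2 + y^2],
      for two variables and degree at least 6;
    - [x^4 + y^4 + z^4 + 3 (x^2 + y^2) z^2 + 3 (x^2 - y^2) z + 3 (x^2 + y^2)],
      for at least three variables and degree at least 4.
    Their convexity has short certificates ([sextic_convex],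
    [quartic_convex]).  If the Hessian were [V^T V], leading terms could not
    cancel in the diagonal entries, so the entries of [V] would have half the
    degree of those of the Hessian ([msize_sos]); comparing coefficients is
    then contradictory ([sextic_hessian_not_gram],
    [quartic_hessian_not_gram]). *)

Import numFieldNormedType.Exports.

Set Implicit Arguments.
Unset Strict Implicit.
Unset Printing Implicit Defensive.

Import Order.TTheory GRing.Theory Num.Theory.
Local Open Scope classical_set_scope.
Local Open Scope ring_scope.

(** * Quadratic forms *)

Section QuadraticForms.
Variable R : realType.

Definition quad n (A : 'M[R]_n) (x : 'cV[R]_n) : R := (x^T *m A *m x) 0 0.
Definition psd_mx n (A : 'M[R]_n) : Prop := forall x, 0 <= quad A x.

Lemma quad_sum n (A : 'M[R]_n) x :
  quad A x = \sum_i \sum_j x i 0 * A i j * x j 0.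
Proof.
rewrite /quad mxE exchange_big /=; apply: eq_bigr => j _.
rewrite mxE mulr_suml; apply: eq_bigr => i _; by rewrite mxE.
Qed.

Lemma quadD n (A B : 'M[R]_n) x : quad (A + B) x = quad A x + quad B x.
Proof. by rewrite /quad mulmxDr mulmxDl mxE. Qed.

Lemma quadZ n c (A : 'M[R]_n) x : quad (c *: A) x = c * quad A x.
Proof. by rewrite /quad -scalemxAr -scalemxAl mxE. Qed.

Lemma quad1 n (x : 'cV[R]_n) : quad 1%:M x = \sum_i x i 0 ^+ 2.
Proof. by rewrite /quad mulmx1 mxE; apply: eq_bigr => i _; rewrite mxE expr2. Qed.

Lemma quad1_ge0 n (x : 'cV[R]_n) : 0 <= quad 1%:M x.
Proof. by rewrite quad1 sumr_ge0 // => i _; rewrite sqr_ge0. Qed.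

Lemma quad1_eq0 n (x : 'cV[R]_n) : (quad 1%:M x == 0) = (x == 0).
Proof.
apply/idP/idP => [|/eqP->]; last by rewrite /quad mulmx0 mxE.
rewrite quad1 psumr_eq0 => [/allP h|i _]; last by rewrite sqr_ge0.
apply/eqP/colP => i; rewrite mxE; apply/eqP.
by have := h i (mem_index_enum i); rewrite sqrf_eq0.
Qed.

Lemma quad_scale n (A : 'M[R]_n) c x : quad A (c *: x) = c ^+ 2 * quad A x.
Proof.
rewrite /quad; have -> : (c *: x)^T = c *: x^T by apply/rowP => j; rewrite !mxE.
by rewrite -!scalemxAl -scalemxAr !mxE mulrA.
Qed.

Lemma quad_congr n k (T : 'M[R]_(k, n)) (A : 'M[R]_k) x :
  quad (T^T *m A *m T) x = quad A (T *m x).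
Proof. by rewrite /quad trmx_mul !mulmxA. Qed.

Lemma quad_addZ n (A : 'M[R]_n) x y e : A^T = A ->
  quad A (x + e *: y) = quad A x + 2 * e * (y^T *m A *m x) 0 0 + e ^+ 2 * quad A y.
Proof.
move=> sA; rewrite /quad.
have -> : (x + e *: y)^T = x^T + e *: y^T by apply/rowP => j; rewrite !mxE.
rewrite !mulmxDl !mulmxDr.
rewrite -!scalemxAl -!scalemxAr.
have -> : x^T *m A *m y = (y^T *m A *m x)^T.
  by rewrite !trmx_mul trmxK sA mulmxA.
rewrite !mxE; ring.
Qed.

(** Kills the terms that are linear in one variable at a zero of a nonnegative
    form. *)
Lemma affine_ge0_slope0 (a b : R) : (forall t, 0 <= a + b * t) -> b = 0.
Proof.
move=> h; apply/eqP/negPn/negP => b0.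
have := h (- (a + 1) / b); have -> : a + b * (- (a + 1) / b) = -1 by field.
lra.
Qed.

(** The first-order condition at a minimum. *)
Lemma quadratic_ge0_slope0 (b c : R) : (forall t, 0 <= b * t + c * t ^+ 2) -> b = 0.
Proof.
move=> h.
have c0 : 0 <= c by have := h 1; have := h (-1); nra.
apply/eqP/negPn/negP => b0.
have := h (- b / (2 * (c + 1))).
have -> : b * (- b / (2 * (c + 1))) + c * (- b / (2 * (c + 1))) ^+ 2
        = - (b ^+ 2 * (c + 2)) / (4 * (c + 1) ^+ 2) by field; lra.
have hb : 0 < b ^+ 2 by rewrite exprn_even_gt0.
rewrite mulNr oppr_ge0 leNgt divr_gt0 //; last by nra.
apply: mulr_gt0 => //; lra.
Qed.

(** Stands in for continuity in [t]: it removes the exceptional value that a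
    division by [t] had to avoid. *)
Lemma quadratic_ge0_punctured (a b c : R) :
  (forall t, t != 0 -> 0 <= a + b * t + c * t ^+ 2) -> 0 <= a.
Proof.
move=> h; rewrite leNgt; apply/negP => a0.
pose d := `|b| + `|c| + 1.
have d0 : 0 < d by rewrite /d; have := normr_ge0 b; have := normr_ge0 c; lra.
pose t := - a / (d - a).
have t0 : 0 < t by rewrite /t divr_gt0 // ?oppr_gt0 // subr_gt0; lra.
have t1 : t * (d - a) = - a by rewrite /t divfK // gt_eqF // subr_gt0; lra.
have := h t; rewrite gt_eqF // => /(_ isT).
have hb := ler_norm b; have hc := ler_norm c.
have tlt1 : t < 1 by nra.
have : b * t <= `|b| * t by rewrite ler_wpM2r // ltW.
have : c * t ^+ 2 <= `|c| * t.
  apply: (le_trans (ler_wpM2r _ hc)); first by rewrite sqr_ge0.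
  by rewrite ler_wpM2l // expr2; nra.
rewrite /d in t1; nra.
Qed.

(** Moving from [x] in the direction [A x] changes the form to first order by
    [2 |A x|^2], and at a minimum this must vanish. *)
Lemma psd_ker n (A : 'M[R]_n) x : A^T = A -> psd_mx A -> quad A x = 0 -> A *m x = 0.
Proof.
move=> sA pA qx; pose y := A *m x.
have h : (y^T *m A *m x) 0 0 = 0.
  suff /eqP : 2 * (y^T *m A *m x) 0 0 = 0 by rewrite mulf_eq0 pnatr_eq0 => /eqP.
  apply: (@quadratic_ge0_slope0 _ (quad A y)) => t.
  by have := pA (x + t *: y); rewrite quad_addZ // qx add0r mulrAC [_ ^+ 2 * _]mulrC.
apply/eqP; rewrite -quad1_eq0; apply/eqP.
by rewrite /quad mulmx1 -[RHS]h -mulmxA.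
Qed.

End QuadraticForms.

(** * Biquadratic forms with two variables on one side *)

Section Pencil.
Variable R : realType.

(** The matrix of the biquadratic form in [x] and [(s, t)], for a fixed
    value of [(s, t)]. *)
Definition pencil n (A B C : 'M[R]_n) (s t : R) : 'M[R]_n :=
  s ^+ 2 *: A + (2 * s * t) *: B + t ^+ 2 *: C.

Lemma quad_pencil n (A B C : 'M[R]_n) s t x :
  quad (pencil A B C s t) x =
  s ^+ 2 * quad A x + 2 * s * t * quad B x + t ^+ 2 * quad C x.
Proof. by rewrite /pencil !quadD !quadZ. Qed.

Lemma fun_continuousD (T : topologicalType) (f g : T -> R) :
  continuous f -> continuous g -> continuous (fun z => f z + g z).
Proof. by move=> cf cg z; apply: cvgD; [exact: cf | exact: cg]. Qed.

Lemma fun_continuousM (T : topologicalType) (f g : T -> R) :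
  continuous f -> continuous g -> continuous (fun z => f z * g z).
Proof. by move=> cf cg z; apply: cvgM; [exact: cf | exact: cg]. Qed.

Lemma sum_continuous (T : topologicalType) (I : Type) (r : seq I) (F : I -> T -> R) :
  (forall i, continuous (F i)) -> continuous (fun z => \sum_(i <- r) F i z).
Proof.
move=> cF; elim: r => [|i r IH].
  under [X in continuous X]funext => z do rewrite big_nil.
  exact: cst_continuous.
under [X in continuous X]funext => z do rewrite big_cons.
exact: fun_continuousD.
Qed.

Lemma quad_continuous (T : topologicalType) n (A : 'M[R]_n) (x : T -> 'cV[R]_n) :
  (forall i, continuous (fun z => x z i 0)) -> continuous (fun z => quad A (x z)).
Proof.
move=> cx; under [X in continuous X]funext => z do rewrite quad_sum.
apply: sum_continuous => i; apply: sum_continuous => j.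
apply: fun_continuousM => //; apply: fun_continuousM => //; exact: cst_continuous.
Qed.

(** On the product of the two unit spheres, which is compact, the biquadratic
    form attains a minimum [l]; homogeneity spreads the bound to all arguments. *)
Lemma pencil_min n (A B C : 'M[R]_n.+1) :
  exists l : R, exists x0 : 'cV[R]_n.+1, exists s0 t0 : R,
  [/\ x0 != 0, s0 ^+ 2 + t0 ^+ 2 = 1,
      quad (pencil A B C s0 t0) x0 = l * quad 1%:M x0 &
      forall x s t, l * (s ^+ 2 + t ^+ 2) * quad 1%:M x <= quad (pencil A B C s t) x].
Proof.
pose xx (z : 'rV[R]_(n.+1 + 2)) : 'cV[R]_n.+1 := \col_i z 0 (lshift 2 i).
pose ss (z : 'rV[R]_(n.+1 + 2)) := z 0 (rshift n.+1 ord0).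
pose tt (z : 'rV[R]_(n.+1 + 2)) := z 0 (rshift n.+1 ord_max).
have cx i : continuous (fun z => xx z i 0).
  under [X in continuous X]funext => z do rewrite mxE.
  exact: coord_continuous.
have cs : continuous ss by exact: coord_continuous.
have ct : continuous tt by exact: coord_continuous.
pose F z := quad (pencil A B C (ss z) (tt z)) (xx z).
have cF : continuous F.
  rewrite /F; under [X in continuous X]funext => z do rewrite quad_pencil !expr2.
  have cc (D : 'M[R]_n.+1) : continuous (fun z => quad D (xx z)) by exact: quad_continuous.
  have cc2 : continuous (fun _ : 'rV[R]_(n.+1 + 2) => 2 : R) by exact: cst_continuous.
  apply: fun_continuousD; first apply: fun_continuousD;
    do 3?[by [] | apply: fun_continuousM => //].
pose G z := quad 1%:M (xx z).
pose H z := ss z * ss z + tt z * tt z.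
have cG : continuous G by exact: quad_continuous.
have cH : continuous H.
  by apply: fun_continuousD; apply: fun_continuousM.
pose K := (G @^-1` [set 1]) `&` (H @^-1` [set 1]).
have clK : closed K.
  apply: closedI; apply: preimage_closed => //; try exact: closed_eq.
have sq1 (a b : R) : 0 <= b -> a * a + b = 1 -> a \in `[-1, 1].
  move=> b0 ab; rewrite in_itv /=; nra.
have cK : compact K.
  pose box := [set v : 'rV[R]_(n.+1 + 2) | forall i, `[-1, 1]%classic (v ord0 i)].
  apply: (@subclosed_compact _ _ box) => //.
    by apply: (@rV_compact R _ (fun=> `[-1, 1]%classic)) => i; exact: segment_compact.
  move=> z [/= Gz Hz] i; rewrite -(splitK i).
  case: (split i) => j /=.
    move: Gz; rewrite /G quad1 (bigD1 j) //= mxE expr2 => Gz.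
    by apply: sq1 Gz; apply: sumr_ge0 => k _; rewrite sqr_ge0.
  have [->|->] : j = ord0 \/ j = ord_max.
    by case: j => [[|[|]]] // ?; [left|right]; apply: val_inj.
  - by apply: sq1 Hz; rewrite -expr2 sqr_ge0.
  - by move: Hz; rewrite /H addrC => Hz; apply: sq1 Hz; rewrite -expr2 sqr_ge0.
pose mk (x : 'cV[R]_n.+1) (s t : R) : 'rV[R]_(n.+1 + 2) :=
  row_mx x^T (\row_j (if j == ord0 then s else t)).
have mkx x s t : xx (mk x s t) = x.
  by apply/colP => i; rewrite mxE row_mxEl mxE.
have mks x s t : ss (mk x s t) = s by rewrite /ss row_mxEr mxE.
have mkt x s t : tt (mk x s t) = t by rewrite /tt row_mxEr mxE.
have K0 : K !=set0.
  exists (mk (delta_mx 0 0) 1 0); split; rewrite /= /G /H ?mkx ?mks ?mkt; last by ring.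
  rewrite quad1 (bigD1 ord0) //= mxE !eqxx big1 => [|i i0]; first by rewrite addr0 expr1n.
  by rewrite mxE (negbTE i0) expr0n.
have [z zK zmin] := compact_EVT_min K0 cK (continuous_subspaceT cF).
have [Gz Hz] : K z by apply/set_mem.
exists (F z), (xx z), (ss z), (tt z); split.
- by rewrite -quad1_eq0 -/(G z) Gz oner_eq0.
- by rewrite !expr2.
- by rewrite -/(G z) Gz mulr1.
move=> x s t.
have [->|x0] := eqVneq x 0.
  by rewrite /quad !mulmx0 !mxE mulr0.
have qx : 0 < quad 1%:M x by rewrite lt_def quad1_eq0 x0 quad1_ge0.
have [st0|st0] := eqVneq (s ^+ 2 + t ^+ 2) 0.
  rewrite st0 mulr0 mul0r.
  move: st0 => /eqP; rewrite paddr_eq0 ?sqr_ge0 // !sqrf_eq0 => /andP[/eqP-> /eqP->].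
  by rewrite quad_pencil expr0n !(mul0r, mulr0) !addr0.
have st : 0 < s ^+ 2 + t ^+ 2 by rewrite lt_def st0 addr_ge0 ?sqr_ge0.
pose a := Num.sqrt (quad 1%:M x); pose b := Num.sqrt (s ^+ 2 + t ^+ 2).
have a0 : 0 < a by rewrite sqrtr_gt0.
have b0 : 0 < b by rewrite sqrtr_gt0.
have a2 : a ^+ 2 = quad 1%:M x by rewrite sqr_sqrtr ?ltW.
have b2 : b ^+ 2 = s ^+ 2 + t ^+ 2 by rewrite sqr_sqrtr ?ltW.
have quads (D : 'M[R]_n.+1) : quad D (a^-1 *: x) = a^-1 ^+ 2 * quad D x.
  exact: quad_scale.
have := zmin (mk (a^-1 *: x) (s / b) (t / b)).
rewrite inE /= => h.
have /h : K (mk (a^-1 *: x) (s / b) (t / b)).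
  split; rewrite /= /G /H ?mkx ?mks ?mkt ?quads -?a2; first by field; rewrite gt_eqF.
  have -> : s / b * (s / b) + t / b * (t / b) = (s ^+ 2 + t ^+ 2) / b ^+ 2.
    by field; rewrite gt_eqF.
  by rewrite -b2 divff // sqrf_eq0 gt_eqF.
rewrite {2}/F mkx mks mkt quads => hh.
have -> : quad (pencil A B C s t) x =
    (a ^+ 2 * b ^+ 2) * (a^-1 ^+ 2 * quad (pencil A B C (s / b) (t / b)) x).
  rewrite !quad_pencil; field; by rewrite !gt_eqF.
have -> : F z * (s ^+ 2 + t ^+ 2) * quad 1%:M x = a ^+ 2 * b ^+ 2 * F z.
  by rewrite a2 b2; ring.
by rewrite ler_wpM2l // mulr_ge0 ?sqr_ge0.
Qed.
End Pencil.

Section PencilSos.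
Variable R : realType.

(** The biquadratic form of [Q] is then [|(s M + t N) x|^2], a sum of squares
    of forms bilinear in [x] and [(s, t)]. *)
Definition sos_pencil n (Q : R -> R -> 'M[R]_n) : Prop :=
  exists (m : nat) (M N : 'M[R]_(m, n)),
    forall s t, Q s t = (s *: M + t *: N)^T *m (s *: M + t *: N).

Lemma sos_pencilD n (Q1 Q2 : R -> R -> 'M[R]_n) :
  sos_pencil Q1 -> sos_pencil Q2 -> sos_pencil (fun s t => Q1 s t + Q2 s t).
Proof.
move=> [m1 [M1 [N1 h1]]] [m2 [M2 [N2 h2]]].
exists (m1 + m2)%N, (col_mx M1 M2), (col_mx N1 N2) => s t.
by rewrite !scale_col_mx add_col_mx tr_col_mx mul_row_col h1 h2.
Qed.

Lemma sos_pencil_congr n k (Q : R -> R -> 'M[R]_k) (T : 'M[R]_(k, n)) :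
  sos_pencil Q -> sos_pencil (fun s t => T^T *m Q s t *m T).
Proof.
move=> [m [M [N h]]]; exists m, (M *m T), (N *m T) => s t.
by rewrite h !scalemxAl -mulmxDl trmx_mul !mulmxA.
Qed.

(** Being a sum of squares is invariant under rotations of [(s, t)]; the
    factors transform by the inverse rotation. *)
Lemma sos_pencil_rot n (Q : R -> R -> 'M[R]_n) c d : c ^+ 2 + d ^+ 2 = 1 ->
  sos_pencil (fun s t => Q (c * s - d * t) (d * s + c * t)) -> sos_pencil Q.
Proof.
move=> cd [m [M [N h]]]; exists m, (c *: M - d *: N), (d *: M + c *: N) => s t.
have := h (c * s + d * t) (c * t - d * s).
have -> : c * (c * s + d * t) - d * (c * t - d * s) = s.
  by rewrite -[RHS]mul1r -cd; ring.
have -> : d * (c * s + d * t) + c * (c * t - d * s) = t.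
  by rewrite -[RHS]mul1r -cd; ring.
move=> ->; congr (_^T *m _); apply/matrixP => i j; rewrite !mxE; ring.
Qed.

Lemma sos_pencil_scalar n (l : R) : 0 <= l ->
  sos_pencil (fun s t => (l * (s ^+ 2 + t ^+ 2)) *: 1%:M : 'M[R]_n).
Proof.
move=> l0; exists (n + n)%N, (col_mx (Num.sqrt l)%:M 0), (col_mx 0 (Num.sqrt l)%:M) => s t.
rewrite !scale_col_mx !scaler0 add_col_mx addr0 add0r tr_col_mx mul_row_col.
rewrite !scale_scalar_mx !tr_scalar_mx -!scalar_mxM -raddfD /=.
rewrite mulr1; congr (_%:M); rewrite -{1}(sqr_sqrtr l0); ring.
Qed.

Lemma sos_pencil_row n (a : R) (u v : 'rV[R]_n) : 0 <= a ->
  sos_pencil (fun s t => a *: ((s *: u + t *: v)^T *m (s *: u + t *: v))).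
Proof.
move=> a0; exists 1%N, (Num.sqrt a *: u), (Num.sqrt a *: v) => s t.
have -> : s *: (Num.sqrt a *: u) + t *: (Num.sqrt a *: v) = Num.sqrt a *: (s *: u + t *: v).
  by rewrite scalerDr !scalerA ![_ * Num.sqrt a]mulrC.
set w := s *: u + t *: v.
have -> : (Num.sqrt a *: w)^T = Num.sqrt a *: w^T by apply/colP => i; rewrite !mxE.
by rewrite -scalemxAl -scalemxAr scalerA -expr2 sqr_sqrtr.
Qed.

Lemma pencil_tr n (A B C : 'M[R]_n) s t : A^T = A -> B^T = B -> C^T = C ->
  (pencil A B C s t)^T = pencil A B C s t.
Proof.
move=> hA hB hC; apply/matrixP => i j.
by rewrite !mxE -[in A j i]hA -[in B j i]hB -[in C j i]hC !mxE.
Qed.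

(** With [b = B x] and [c = C x], the hypothesis at [(s, t) = (1, 0)] gives
    [A x = 0], and then [b] is orthogonal to [x], because the value at [x] for
    [t = 1] is nonnegative and affine in [s].  So [Q(s, t) x = t r(s, t)^T] with
    [r = 2 s b^T + t c^T], and the Schur complement of [x] in [Q] is
    [Q - r^T r / al], where [al] is the value of [C] at [x]: the factor [t^2] has
    cancelled, so this is again a pencil.  If [al = 0] then [b] and [c] vanish
    and nothing is subtracted.  The cancellation is what fails when the second
    group has three variables. *)
Lemma pencil_deflate n (A B C : 'M[R]_n) (x : 'cV[R]_n) :
  A^T = A -> B^T = B -> C^T = C ->
  (forall s t, psd_mx (pencil A B C s t)) -> quad A x = 0 ->
  exists A' B' C' : 'M[R]_n,
  [/\ [/\ A'^T = A', B'^T = B' & C'^T = C'],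
      [/\ A' *m x = 0, B' *m x = 0 & C' *m x = 0],
      forall s t, psd_mx (pencil A' B' C' s t) &
      sos_pencil (pencil A' B' C') -> sos_pencil (pencil A B C)].
Proof.
move=> sA sB sC pQ qA.
have pA : psd_mx A.
  move=> y; have := pQ 1 0 y.
  by rewrite quad_pencil expr1n mul1r mulr0 mul0r expr0n mul0r !addr0.
have pC : psd_mx C.
  move=> y; have := pQ 0 1 y.
  by rewrite quad_pencil expr1n mul1r mulr0 !mul0r expr0n mul0r !add0r.
have Ax : A *m x = 0 by exact: psd_ker.
have qB : quad B x = 0.
  apply/eqP; have /eqP : 2 * quad B x = 0.
    apply: (@affine_ge0_slope0 _ (quad C x)) => t.
    have := pQ t 1 x; rewrite quad_pencil qA mulr0 add0r; lra.
  by rewrite mulf_eq0 pnatr_eq0.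
set al := quad C x.
have al0 : 0 <= al by exact: pC.
pose b := B *m x; pose c := C *m x.
have Qx s t : pencil A B C s t *m x = t *: (s *: (2 *: b) + t *: c).
  rewrite /pencil !mulmxDl -!scalemxAl Ax scaler0 add0r -/b -/c.
  by apply/colP => i; rewrite !mxE; ring.
have bx : (x^T *m b) 0 0 = 0 by rewrite mulmxA.
have cx : (x^T *m c) 0 0 = al by rewrite mulmxA.
have xb : b^T *m x = 0.
  by rewrite -[x]trmxK -trmx_mul; apply/matrixP => i j; rewrite !ord1 mxE bx mxE.
have xc : c^T *m x = al%:M.
  rewrite -[x]trmxK -trmx_mul; apply/matrixP => i j.
  by rewrite !ord1 mxE cx mxE eqxx mulr1n.
pose r s t : 'rV[R]_n := s *: (2 *: b^T) + t *: c^T.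
have rx s t : r s t *m x = (t * al)%:M.
  by rewrite mulmxDl -!scalemxAl xb xc !scaler0 add0r scale_scalar_mx.
have al_r s t : al = 0 -> r s t = 0.
  move=> h; have c0 : c = 0 by exact: psd_ker.
  have := Qx 1 1.
  have -> : pencil A B C 1 1 *m x = 0.
    by apply: psd_ker; rewrite ?pencil_tr // quad_pencil qA qB -/al h !mulr0 !addr0.
  rewrite !scale1r c0 addr0 => b0.
  have b00 : b = 0 by apply/eqP; move/esym/eqP: b0; rewrite scaler_eq0 pnatr_eq0.
  by rewrite /r b00 c0 trmx0 !scaler0 addr0.
pose A' := A - (4 * al^-1) *: (b *m b^T).
pose B' := B - al^-1 *: (b *m c^T + c *m b^T).
pose C' := C - al^-1 *: (c *m c^T).
have QE s t : pencil A B C s t = pencil A' B' C' s t + al^-1 *: ((r s t)^T *m r s t).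
  have -> : (r s t)^T = s *: (2 *: b) + t *: c by apply/colP => i; rewrite !mxE.
  rewrite /r !mulmxDl !mulmxDr -!scalemxAl -!scalemxAr /pencil /A' /B' /C'.
  move: (b *m b^T) (b *m c^T) (c *m b^T) (c *m c^T) => X Y Z W.
  by apply/matrixP => i j; rewrite !mxE; ring.
have Q'x s t : pencil A' B' C' s t *m x = 0.
  have /eqP := Qx s t; rewrite QE mulmxDl -scalemxAl -mulmxA rx mul_mx_scalar.
  have -> : (r s t)^T = s *: (2 *: b) + t *: c by apply/colP => i; rewrite !mxE.
  rewrite [al^-1 *: _]scalerA mulrCA.
  have [al00|aln0] := eqVneq al 0; last first.
    by rewrite mulVf // mulr1 -[X in _ == X]add0r => /eqP /addIr.
  have -> : s *: (2 *: b) + t *: c = 0.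
    by apply: trmx_inj; rewrite trmx0 -(al_r s t al00); apply/rowP => i; rewrite !mxE.
  by rewrite !scaler0 addr0 => /eqP.
have sym' : [/\ A'^T = A', B'^T = B' & C'^T = C'].
  have tr_bc (u v : 'cV[R]_n) : (u *m v^T)^T = v *m u^T by rewrite trmx_mul trmxK.
  split; rewrite raddfB /= linearZ /= ?raddfD /= ?tr_bc ?sA ?sB ?sC //.
  by rewrite /B' scalerDr opprD (addrC (- (al^-1 *: (b *m c^T)))).
clearbody A' B' C'.
exists A', B', C'; split => //.
- have A0 : A' *m x = 0.
    by have := Q'x 1 0; rewrite /pencil expr1n mulr0 expr0n !scale0r !addr0 scale1r.
  have C0 : C' *m x = 0.
    by have := Q'x 0 1; rewrite /pencil expr1n !mulr0 expr0n mul0r !scale0r !add0r scale1r.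
  have /eqP : 2 *: (B' *m x) = 0.
    have := Q'x 1 1.
    by rewrite /pencil !mulmxDl -!scalemxAl A0 C0 !scaler0 add0r addr0 !mulr1.
  by rewrite scaler_eq0 pnatr_eq0 => /eqP.
- move=> s t y.
  have key s' t' : t' != 0 -> 0 <= quad (pencil A' B' C' s' t') y.
    move=> t0; pose k := (r s' t' *m y) 0 0 / (t' * al).
    have sQ' : (pencil A' B' C' s' t')^T = pencil A' B' C' s' t'.
      by case: sym' => *; exact: pencil_tr.
    have qE z : quad (pencil A B C s' t') z =
        quad (pencil A' B' C' s' t') z + al^-1 * ((r s' t' *m z) 0 0) ^+ 2.
      rewrite QE quadD quadZ; congr (_ + _ * _).
      rewrite /quad mulmxA -trmx_mul -mulmxA [r s' t' *m z]mx11_scalar tr_scalar_mx.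
      rewrite -scalar_mxM mxE eqxx mulr1n.
      by rewrite !mxE /= mulr1n expr2.
    have [al00|aln0] := eqVneq al 0.
      by have := pQ s' t' y; rewrite qE al_r // mul0mx mxE expr0n mulr0 addr0.
    have := pQ s' t' (y + (- k) *: x).
    rewrite qE quad_addZ // -mulmxA.
    have -> : (x^T *m (pencil A' B' C' s' t' *m y)) 0 0 = 0.
      have -> : x^T *m (pencil A' B' C' s' t' *m y) = (y^T *m (pencil A' B' C' s' t' *m x))^T.
        by rewrite !trmx_mul trmxK sQ' mulmxA.
      by rewrite Q'x mulmx0 trmx0 mxE.
    have -> : quad (pencil A' B' C' s' t') x = 0 by rewrite /quad -mulmxA Q'x mulmx0 mxE.
    have -> : (r s' t' *m (y + - k *: x)) 0 0 = 0.
      rewrite mulmxDr -scalemxAr rx scale_scalar_mx mxE [X in _ + X]mxE eqxx mulr1n.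
      by rewrite /k mulNr divfK ?mulf_neq0 // subrr.
    by rewrite !mulr0 expr0n mulr0 !addr0.
  (* the share of [x] in [y] is divided by [t], so [t = 0] is a limit case *)
  have [->|] := eqVneq t 0; last exact: key.
  rewrite quad_pencil mulr0 mul0r expr0n mul0r !addr0.
  apply: (@quadratic_ge0_punctured _ _ (2 * s * quad B' y) (quad C' y)) => e e0.
  have := key s e e0; rewrite quad_pencil; lra.
- move=> h; have := sos_pencilD h (sos_pencil_row (2 *: b^T) c^T (_ : 0 <= al^-1)).
  rewrite invr_ge0 al0 => /(_ isT) [m [M [N hh]]]; exists m, M, N => s t.
  by rewrite QE hh.
Qed.
End PencilSos.

Section PencilMain.
Variable R : realType.

(** Symmetric matrices killed by [x] only see the orthogonal projection along
    [x], which has rank less than [n] and so factors through a smaller space. *)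
Lemma kernel_compression n (x : 'cV[R]_n) : x != 0 ->
  exists k : nat, (k < n)%N /\ exists (S : 'M[R]_(n, k)) (T : 'M[R]_(k, n)),
    forall X : 'M[R]_n, X^T = X -> X *m x = 0 -> T^T *m (S^T *m X *m S) *m T = X.
Proof.
move=> x0; pose q := quad 1%:M x.
have q0 : q != 0 by rewrite quad1_eq0.
pose P : 'M[R]_n := 1%:M - q^-1 *: (x *m x^T).
have Px : P *m x = 0.
  rewrite mulmxBl mul1mx -scalemxAl -mulmxA.
  have -> : x^T *m x = q%:M by rewrite [LHS]mx11_scalar /q /quad mulmx1.
  by rewrite mul_mx_scalar scalerA mulVf // scale1r subrr.
exists (\rank P); split.
  rewrite ltn_neqAle rank_leq_row andbT; apply/negP => /eqP rP.
  have uP : P \in unitmx by rewrite -row_free_unit /row_free rP.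
  by move/eqP: x0; apply; rewrite -(mulKmx uP x) Px mulmx0.
exists (col_base P), (row_base P) => X sX Xx.
have XP : X *m P = X.
  by rewrite mulmxBr mulmx1 -scalemxAr mulmxA Xx mul0mx scaler0 subr0.
have PX : P^T *m X = X by rewrite -{1}sX -trmx_mul XP sX.
transitivity (P^T *m X *m P); last by rewrite PX XP.
move: (col_base P) (row_base P) (mulmx_base P) => S T ST.
have -> : P^T *m X *m P = (S *m T)^T *m X *m (S *m T) by rewrite ST.
by rewrite trmx_mul !mulmxA.
Qed.

(** Each step replaces the pencil by one of smaller size: subtract the minimum
    [l] of the form on the spheres, rotate its location to [(s, t) = (1, 0)],
    split off one square, and compress along the zero. *)
Lemma psd_pencil_sos n (A B C : 'M[R]_n) :
  A^T = A -> B^T = B -> C^T = C ->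
  (forall s t, psd_mx (pencil A B C s t)) -> sos_pencil (pencil A B C).
Proof.
elim/ltn_ind: n A B C => -[|n] IH A B C sA sB sC pQ.
  by exists 0%N, 0, 0 => s t; apply/matrixP => -[].
have [l [x [c [d [x0 cd ql lmin]]]]] := pencil_min A B C.
have qx : 0 < quad 1%:M x by rewrite lt_def quad1_eq0 x0 quad1_ge0.
have l0 : 0 <= l by rewrite -(pmulr_lge0 _ qx) -ql; exact: pQ.
(* the pencil minus its minimum, rotated so that its zero is at [(1, 0)] *)
pose A1 := pencil A B C c d - l%:M.
pose B1 := (c * d) *: (C - A) + (c ^+ 2 - d ^+ 2) *: B.
pose C1 := pencil A B C (- d) c - l%:M.
have E s t : pencil A B C (c * s - d * t) (d * s + c * t) =
    pencil A1 B1 C1 s t + (l * (s ^+ 2 + t ^+ 2)) *: 1%:M.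
  rewrite /A1 /B1 /C1 /pencil -[l%:M]scalemx1.
  move: (1%:M : 'M[R]_n.+1) => I1.
  by apply/matrixP => i j; rewrite !mxE; ring.
apply: (sos_pencil_rot cd).
have sA1 : A1^T = A1 by rewrite /A1 raddfB /= pencil_tr // tr_scalar_mx.
have sC1 : C1^T = C1 by rewrite /C1 raddfB /= pencil_tr // tr_scalar_mx.
have sB1 : B1^T = B1 by rewrite /B1 raddfD /= !linearZ /= raddfB /= sA sB sC.
have pQ1 s t : psd_mx (pencil A1 B1 C1 s t).
  move=> y; have := lmin y (c * s - d * t) (d * s + c * t).
  rewrite E quadD quadZ.
  have -> : (c * s - d * t) ^+ 2 + (d * s + c * t) ^+ 2 = s ^+ 2 + t ^+ 2.
    by rewrite -[RHS]mul1r -cd; ring.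
  by rewrite lerDr.
have qA1 : quad A1 x = 0.
  by rewrite /A1 quadD -scaleN1r quadZ -[l%:M]scalemx1 quadZ ql mulN1r subrr.
have [A2 [B2 [C2 [[sA2 sB2 sC2] [A2x B2x C2x] pQ2 back]]]] :=
  pencil_deflate sA1 sB1 sC1 pQ1 qA1.
have [k [kn [S [T ST]]]] := kernel_compression x0.
have symS (X : 'M[R]_n.+1) : X^T = X -> (S^T *m X *m S)^T = S^T *m X *m S.
  by move=> sX; rewrite !trmx_mul trmxK sX mulmxA.
have SE s t : pencil (S^T *m A2 *m S) (S^T *m B2 *m S) (S^T *m C2 *m S) s t =
              S^T *m pencil A2 B2 C2 s t *m S.
  by rewrite /pencil !mulmxDr !mulmxDl -!scalemxAr -!scalemxAl.
have pS s t : psd_mx (pencil (S^T *m A2 *m S) (S^T *m B2 *m S) (S^T *m C2 *m S) s t).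
  by move=> y; rewrite SE quad_congr; exact: pQ2.
have sosS := IH k kn _ _ _ (symS _ sA2) (symS _ sB2) (symS _ sC2) pS.
have sos2 : sos_pencil (pencil A2 B2 C2).
  have [m [M [N h]]] := sos_pencil_congr T sosS.
  exists m, M, N => s t; rewrite -h SE ST ?pencil_tr //.
  by rewrite /pencil !mulmxDl -!scalemxAl A2x B2x C2x !scaler0 !addr0.
have [m [M [N h]]] := sos_pencilD (back sos2) (@sos_pencil_scalar R n.+1 l l0).
by exists m, M, N => s t; rewrite E h.
Qed.
End PencilMain.

(** * Nonnegative univariate polynomials *)

Section Univariate.
Variable R : realType.

Lemma poly_ge0_right (p : {poly R}) a : (forall x, a < x -> 0 <= p.[x]) -> 0 <= p.[a].
Proof.
move=> h; rewrite leNgt; apply/negP => pa.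
have e0 : 0 < - p.[a] by rewrite oppr_gt0.
have [d d0 hd] := poly_cont a p e0.
have := hd (a + d / 2); rewrite addrAC subrr add0r gtr0_norm; last by rewrite divr_gt0.
have -> : d / 2 < d by lra.
move=> /(_ isT); have := h (a + d / 2); rewrite ltrDl divr_gt0 // => /(_ isT) h1.
rewrite ltr_norml => /andP[_]; lra.
Qed.

Lemma poly_le0_left (p : {poly R}) a : (forall x, x < a -> p.[x] <= 0) -> p.[a] <= 0.
Proof.
move=> h; have := @poly_ge0_right (- p \Po (- 'X)) (- a).
rewrite !(hornerN, horner_comp, hornerX) opprK oppr_ge0; apply=> x ax.
by rewrite !(hornerN, horner_comp, hornerX) oppr_ge0 h // ltrNl.
Qed.

(** Induction on the degree.  A complex root [a + i b] gives the nonnegative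
    quadratic factor [(X - a)^2 + b^2]: if [b] is nonzero since the conjugate
    is a root too, and if [b = 0] since a nonnegative polynomial changes sign at
    no root, so that the root is double.  The cofactor is nonnegative, and
    multiplying its sum of squares by the factor doubles the number of squares. *)
Lemma nonneg_poly_sos (p : {poly R}) : (forall x, 0 <= p.[x]) ->
  exists s : seq {poly R}, p = \sum_(q <- s) q ^+ 2.
Proof.
have [k] := ubnP (size p); elim: k p => // k IH p sp p0.
have [s1|s1] := leqP (size p) 1.
  exists [:: (Num.sqrt p`_0)%:P]; rewrite big_seq1 -rmorphXn /= sqr_sqrtr.
    exact: size1_polyC.
  by have := p0 0; rewrite horner_coef0.
have pn0 : p != 0 by rewrite -size_poly_gt0 (ltn_trans _ s1).
have [z rz] : exists z, root (map_poly (real_complex R) p) z.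
  by apply/closed_rootP; rewrite size_map_poly neq_ltn s1 orbT.
case: z rz => a b rz.
pose d : {poly R} := ('X - a%:P) ^+ 2 + (b ^+ 2)%:P.
suff [q pq q0] : exists2 q, p = q * d & forall x, 0 <= q.[x].
  have qn0 : q != 0 by apply: contraNneq pn0 => q0'; rewrite pq q0' mul0r.
  have sd : size d = 3%N.
    rewrite /d size_polyDl ?size_exp_XsubC //.
    by rewrite (leq_ltn_trans (size_polyC_leq1 _)).
  have dn0 : d != 0 by rewrite -size_poly_gt0 sd.
  have [|s qs] := IH q _ q0.
    by move: sp; rewrite pq size_mul // sd addn3 /= => /ltnSE/ltnW.
  exists ([seq r * ('X - a%:P) | r <- s] ++ [seq r * b%:P | r <- s]).
  rewrite big_cat !big_map /= pq {1}qs mulrDr !mulr_suml; congr (_ + _).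
    by apply: eq_bigr => r _; rewrite exprMn.
  by apply: eq_bigr => r _; rewrite exprMn -rmorphXn.
have [b0|b0] := eqVneq b 0.
  have ra : root p a.
    move: rz; rewrite b0 (_ : a +i* 0 = real_complex R a)%C // /root horner_map.
    by rewrite fmorph_eq0.
  have [q pq] := factor_theorem p a ra.
  have qa : root q a.
    apply/eqP/le_anti/andP; split.
      apply: poly_le0_left => x xa; have := p0 x.
      by rewrite pq hornerM hornerXsubC nmulr_lge0 // subr_lt0.
    apply: poly_ge0_right => x xa; have := p0 x.
    by rewrite pq hornerM hornerXsubC pmulr_lge0 // subr_gt0.
  have [r qr] := factor_theorem q a qa.
  have pr : p = r * d.
    by rewrite pq qr -?mulrA /d b0 expr0n addr0 expr2 mulrA.
  have rp x : x != a -> 0 <= r.[x].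
    move=> xa; have := p0 x; rewrite pr /d b0 expr0n addr0 hornerM horner_exp hornerXsubC.
    by rewrite pmulr_lge0 // exprn_even_gt0 //= subr_eq0.
  exists r => // x; have [->|] := eqVneq x a; last exact: rp.
  by apply: poly_ge0_right => y ay; apply: rp; rewrite gt_eqF.
have sd : size d = 3%N.
  rewrite /d size_polyDl ?size_exp_XsubC //.
  by rewrite (leq_ltn_trans (size_polyC_leq1 _)).
have dn0 : d != 0 by rewrite -size_poly_gt0 sd.
have dz : (map_poly (real_complex R) d).[(a +i* b)%C] = 0.
  rewrite /d rmorphD rmorphXn rmorphB /= map_polyX !map_polyC /=.
  rewrite !hornerE /=; apply/eqP; rewrite eq_complex /=; apply/andP; split; apply/eqP; ring.
have r0 : modp p d = 0.
  have sr : (size (modp p d) <= 2)%N by rewrite -ltnS -sd ltn_modp.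
  have := rz; rewrite /root {1}(divp_eq p d) rmorphD rmorphM /= hornerD hornerM dz mulr0 add0r.
  rewrite (@horner_coef_wide _ 2) ?size_map_poly // !big_ord_recl big_ord0 /= !coef_map /=.
  rewrite eq_complex /= => /andP[/eqP h0 /eqP h1].
  have r1 : (modp p d)`_1 = 0.
    have /eqP : (modp p d)`_1 * b = 0 by rewrite -[RHS]h1; ring.
    by rewrite mulf_eq0 (negbTE b0) orbF => /eqP.
  have r00 : (modp p d)`_0 = 0 by rewrite -[RHS]h0 r1; ring.
  apply/polyP => i; rewrite coef0; case: i => [|[|i]] //.
  by rewrite nth_default // (leq_trans sr).
have pd : p = p %/ d * d by rewrite {1}(divp_eq p d) r0 addr0.
exists (p %/ d) => // x.
have := p0 x; rewrite {1}pd hornerM pmulr_lge0 //.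
rewrite /d hornerD horner_exp hornerXsubC hornerC.
by rewrite ltr_wpDl ?sqr_ge0 // exprn_even_gt0.
Qed.

End Univariate.

(** * Restriction to lines and convexity *)

Section Lines.
Variable R : realType.

(** Constants and variables generate the ring of polynomials; identities
    between ring morphisms and derivations follow from this. *)
Lemma mpoly_ring_ind n (P : {mpoly R[n]} -> Prop) :
  (forall c, P c%:MP) -> (forall i, P 'X_i) ->
  (forall p q, P p -> P q -> P (p + q)) -> (forall p q, P p -> P q -> P (p * q)) ->
  forall p, P p.
Proof.
move=> PC PX PD PM p; rewrite (mpolyE p).
apply: (big_ind P) => [||m _]; [exact: (PC 0) | exact: PD |].
rewrite -mul_mpolyC; apply: (PM _ _ (PC _)); rewrite mpolyXE_id.
apply: (big_ind P) => [||i _]; [by rewrite -mpolyC1 | exact: PM |].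
by elim: (m i) => [|k IH]; rewrite ?expr0 -?mpolyC1 // exprS; apply: PM.
Qed.

Definition line n (p : {mpoly R[n]}) (x v : 'I_n -> R) : {poly R} :=
  mmap (@polyC R) (fun i => (x i)%:P + v i *: 'X) p.

Lemma lineD n (x v : 'I_n -> R) p q : line (p + q) x v = line p x v + line q x v.
Proof. exact: mmapD. Qed.
Lemma lineM n (x v : 'I_n -> R) p q : line (p * q) x v = line p x v * line q x v.
Proof. exact: rmorphM. Qed.
Lemma lineC n (x v : 'I_n -> R) c : line c%:MP x v = c%:P.
Proof. exact: mmapC. Qed.
Lemma lineX n (x v : 'I_n -> R) i : line 'X_i x v = (x i)%:P + v i *: 'X.
Proof. by rewrite /line mmapX mmap1U. Qed.

Lemma horner_line n (p : {mpoly R[n]}) x v t :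
  (line p x v).[t] = p.@[fun i => x i + t * v i].
Proof.
elim/mpoly_ring_ind: p => [c|i|p q hp hq|p q hp hq].
- by rewrite lineC hornerC mevalC.
- by rewrite lineX mevalXU !hornerE mulrC.
- by rewrite lineD hornerD mevalD hp hq.
- by rewrite lineM hornerM mevalM hp hq.
Qed.

Lemma deriv_line n (p : {mpoly R[n]}) x v :
  (line p x v)^`() = \sum_i v i *: line p^`M(i) x v.
Proof.
elim/mpoly_ring_ind: p => [c|i|p q hp hq|p q hp hq].
- rewrite lineC derivC big1 // => i _; by rewrite mderivC -[0]mpolyC0 lineC scaler0.
- rewrite lineX derivD derivC derivZ derivX add0r (bigD1 i) //= big1 => [|j ji].
    rewrite addr0 mderivX mnmE eqxx scale1r.
    have -> : (U_(i) - U_(i) = 0 :> 'X_{1..n})%MM by apply/mnmP => k; rewrite !mnmE subnn.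
    by rewrite mpolyX0 -mpolyC1 lineC.
  by rewrite mderivX mnmE eq_sym (negbTE ji) scale0r -[0]mpolyC0 lineC scaler0.
- rewrite lineD derivD hp hq -big_split; apply: eq_bigr => i _ /=.
  by rewrite mderivD lineD scalerDr.
- rewrite lineM derivM hp hq mulr_suml mulr_sumr -big_split; apply: eq_bigr => i _ /=.
  by rewrite mderivM lineD !lineM scalerDr -scalerAl -scalerAr.
Qed.

Definition hessian_form n (p : {mpoly R[n]}) (x v : 'I_n -> R) : R :=
  \sum_i \sum_j v i * v j * (hessian p i j).@[x].

Lemma deriv2_line n (p : {mpoly R[n]}) x v t :
  ((line p x v)^`()^`()).[t] = hessian_form p (fun i => x i + t * v i) v.
Proof.
rewrite deriv_line raddf_sum horner_sum /hessian_form exchange_big; apply: eq_bigr => j _ /=.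
rewrite derivZ deriv_line hornerZ horner_sum mulr_sumr; apply: eq_bigr => i _.
by rewrite hornerZ mxE horner_line mulrA [v j * _]mulrC.
Qed.

(** The mean value theorem on both sides of [t] turns the chord inequality into
    monotonicity of the derivative. *)
Lemma poly_convex (q : {poly R}) : (forall t, 0 <= q^`()^`().[t]) ->
  forall t, 0 <= t <= 1 -> q.[t] <= (1 - t) * q.[0] + t * q.[1].
Proof.
move=> q2 t /andP[]; rewrite le_eqVlt => /predU1P[<- _|t0].
  by rewrite subr0 mul1r mul0r addr0.
rewrite le_eqVlt => /predU1P[->|t1]; first by rewrite subrr mul0r mul1r add0r.
have [c1 /andP[c1l c1r] h1] := poly_mvt q t0.
have [c2 /andP[c2l c2r] h2] := poly_mvt q t1.
rewrite !bnd_simp in c1l c1r c2l c2r.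
have c12 : c1 < c2 by exact: lt_trans c1r c2l.
have [c3 _ h3] := poly_mvt q^`() c12.
have h4 : q^`().[c1] <= q^`().[c2].
  by rewrite -subr_ge0 h3 mulr_ge0 // subr_ge0 ltW.
rewrite subr0 in h1.
have -> : (1 - t) * q.[0] + t * q.[1] = q.[t] - (1 - t) * (q.[t] - q.[0]) + t * (q.[1] - q.[t]).
  by ring.
rewrite h1 h2.
have : 0 <= t * (1 - t) * (q^`().[c2] - q^`().[c1]).
  by rewrite !mulr_ge0 ?subr_ge0 ?(ltW t0) ?(ltW t1).
lra.
Qed.

(** The second difference [q(t) + q(-t) - 2 q(0)] is [t^2] times a polynomial
    whose value at [0] is [q''(0)]; only midpoint convexity is involved. *)
Lemma poly_midpoint (q : {poly R}) : (forall t, 2 * q.[0] <= q.[t] + q.[- t]) ->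
  0 <= q^`()^`().[0].
Proof.
move=> h.
have [r qr] : exists r : {poly R}, q = (q`_0)%:P + q`_1 *: 'X + r * 'X^2.
  exists (\poly_(i < size q) q`_(i.+2)); apply/polyP => i.
  rewrite !coefD coefC coefZ coefX coefMXn coef_poly.
  case: i => [|[|i]] //=; rewrite ?(mulr1, mulr0, addr0, add0r) // !subSS subn0.
  case: ltnP => // si; apply: nth_default; exact: (leq_trans si (leqW (leqnSn _))).
have q2 : q^`()^`().[0] = 2 * r.[0].
  by rewrite qr ![('X^2)%R]expr2 !(derivD, derivC, derivZ, derivX, derivM) !hornerE /=; ring.
rewrite q2 mulr_ge0 //.
pose s := r + (r \Po (- 'X)).
have sE t : s.[t] = r.[t] + r.[- t] by rewrite /s hornerD horner_comp !hornerE.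
suff : 0 <= s.[0] by rewrite sE oppr0; lra.
have hs t : 0 < t -> 0 <= s.[t].
  move=> t0; have := h t.
  rewrite sE qr !(hornerD, hornerZ, hornerC, hornerX, hornerM, hornerXn) => ht.
  have t2 : 0 < t ^+ 2 by rewrite exprn_gt0.
  rewrite -(pmulr_rge0 _ t2); move: ht; lra.
exact: poly_ge0_right.
Qed.
End Lines.

Section Convex.
Variable R : realType.

Lemma convex_polyP n (p : {mpoly R[n]}) :
  convex_poly p <-> forall x v, 0 <= hessian_form p x v.
Proof.
split=> [cp x v|H t x y _ _].
  have -> : hessian_form p x v = ((line p x v)^`()^`()).[0].
    rewrite deriv2_line; congr hessian_form; apply/funext => i.
    by rewrite mul0r addr0.
  apply: poly_midpoint => t.
  have h0 : 0 <= (2^-1 : R) by rewrite invr_ge0.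
  have h1 : (2^-1 : R) <= 1 by rewrite invf_le1 // ler1n.
  have := cp (Itv01 h0 h1) (\row_i (x i + t * v i)) (\row_i (x i - t * v i)).
  rewrite !inE => /(_ Logic.I Logic.I); rewrite convRE /= /unstable.onem !horner_line.
  have -> : (fun i => x i + 0 * v i) =
    (convex.conv (Itv01 h0 h1) (\row_i (x i + t * v i) : convex_lmodType _)
                 (\row_i (x i - t * v i))) ord0.
    apply/funext => i; rewrite !mxE /= /unstable.onem; lra.
  have -> : (\row_i (x i + t * v i)) ord0 = (fun i => x i + t * v i).
    by apply/funext => i; rewrite mxE.
  have -> : (\row_i (x i - t * v i)) ord0 = (fun i => x i + - t * v i).
    by apply/funext => i; rewrite mxE mulNr.
  lra.
pose v i := x ord0 i - y ord0 i.
have := @poly_convex _ (line p (y ord0) v) _ t%:num.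
rewrite !horner_line convRE /= /unstable.onem ge0 le1.
have -> : (fun i => y ord0 i + 0 * v i) = y ord0 by apply/funext => i; rewrite mul0r addr0.
have -> : (fun i => y ord0 i + 1 * v i) = x ord0.
  by apply/funext => i; rewrite /v; ring.
have -> : (fun i => y ord0 i + t%:num * v i) = (convex.conv t x y) ord0.
  by apply/funext => i; rewrite !mxE /v /= /unstable.onem; ring.
move=> h; rewrite addrC; apply: h => // s.
by rewrite deriv2_line; exact: H.
Qed.
End Convex.

(** * The cases where convex polynomials are sos-convex *)

Section Positive.
Variable R : realType.

Lemma hessian_tr n (p : {mpoly R[n]}) : (hessian p)^T = hessian p.
Proof. by apply/matrixP => i j; rewrite !mxE mderiv_comm. Qed.

Lemma sos_convex_convex n (p : {mpoly R[n]}) : sos_convex_poly p -> convex_poly p.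
Proof.
move=> [m [V HV]]; apply/convex_polyP => x v; rewrite /hessian_form HV.
have -> : \sum_i \sum_j v i * v j * ((V^T *m V) i j).@[x] =
          \sum_k (\sum_i v i * (V k i).@[x]) ^+ 2.
  under eq_bigr => i _ do under eq_bigr => j _ do rewrite mxE raddf_sum mulr_sumr.
  under eq_bigr => i _ do rewrite exchange_big.
  rewrite exchange_big; apply: eq_bigr => k _ /=.
  rewrite expr2 mulr_suml; apply: eq_bigr => i _; rewrite mulr_sumr; apply: eq_bigr => j _.
  by rewrite mxE mevalM; ring.
by apply: sumr_ge0 => k _; exact: sqr_ge0.
Qed.

Lemma msize_mderiv n (p : {mpoly R[n]}) i : (msize p^`M(i) <= (msize p).-1)%N.
Proof.
rewrite msizeE; apply/bigmax_leqP_seq => m; rewrite mcoeff_msupp mcoeff_deriv => h _.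
have : (m + U_(i))%MM \in msupp p.
  by rewrite mcoeff_msupp; apply: contraNneq h => ->; rewrite mul0rn.
by move/msize_mdeg_lt; rewrite mdegD mdeg1 addn1; case: (msize p).
Qed.

Lemma msize_hessian n (p : {mpoly R[n]}) i j : (msize (hessian p i j) <= (msize p).-2)%N.
Proof.
rewrite mxE (leq_trans (msize_mderiv _ _)) //.
by have := msize_mderiv p j; case: (msize _) => // a; case: (msize p) => [|[|b]].
Qed.

(** Univariate polynomials in the two representations are exchanged by
    restriction to the line through [0] with direction [1], and evaluation at
    the variable. *)
Lemma sos_convex_univariate (p : {mpoly R[1]}) : convex_poly p -> sos_convex_poly p.
Proof.
move/convex_polyP => cp; pose h := hessian p 0 0.
pose x0 : 'I_1 -> R := fun=> 0; pose x1 : 'I_1 -> R := fun=> 1.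
have [|s hs] := @nonneg_poly_sos _ (line h x0 x1).
  move=> t; rewrite horner_line; have := cp (fun i => x0 i + t * x1 i) x1.
  by rewrite /hessian_form !big_ord1 /x1 !mul1r.
pose back (q : {poly R}) := (map_poly (@mpolyC 1 R) q).['X_0].
have backK (g : {mpoly R[1]}) : back (line g x0 x1) = g.
  rewrite /back; elim/mpoly_ring_ind: g => [c|i|g1 g2 h1 h2|g1 g2 h1 h2].
  - by rewrite lineC map_polyC hornerC.
  - rewrite lineX rmorphD /= map_polyC /= hornerD hornerC mpolyC0 add0r scale1r.
    by rewrite map_polyX hornerX ord1.
  - by rewrite lineD rmorphD /= hornerD h1 h2.
  - by rewrite lineM rmorphM /= hornerM h1 h2.
exists (size s), (\matrix_(k < size s, j < 1) back s`_k).
apply/matrixP => i j; rewrite !ord1 -[LHS]backK -/h hs mxE (big_nth 0) big_mkord.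
rewrite /back rmorph_sum horner_sum; apply: eq_bigr => k _.
by rewrite !mxE rmorphXn /= horner_exp expr2.
Qed.

Lemma sos_convex_quadratic n (p : {mpoly R[n]}) :
  (msize p <= 3)%N -> convex_poly p -> sos_convex_poly p.
Proof.
move=> sp /convex_polyP cp.
pose A : 'M[R]_n := \matrix_(i, j) (hessian p i j)@_0%MM.
have HA : hessian p = map_mx (@mpolyC n R) A.
  apply/matrixP => i j; rewrite [RHS]mxE [A i j]mxE; apply: msize1_polyC.
  by apply: leq_trans (msize_hessian p i j) _; move: sp; case: (msize p) => [|[|]].
have sA : A^T = A.
  by apply/matrixP => i j; rewrite mxE [LHS]mxE -{1}hessian_tr [in RHS]mxE mxE.
have pA : psd_mx A.
  move=> y; have := cp (fun=> 0) (fun i => y i 0); rewrite /hessian_form quad_sum HA.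
  congr (0 <= _); apply: eq_bigr => i _; apply: eq_bigr => j _.
  by rewrite mxE mevalC mulrAC.
have [s t|m [M [N h]]] := psd_pencil_sos sA (trmx0 R n n) (trmx0 R n n).
  move=> y; rewrite quad_pencil /(quad 0) !mulmx0 !mul0mx !mxE !mulr0 !addr0.
  by rewrite mulr_ge0 ?sqr_ge0 //; exact: pA.
have AE : A = M^T *m M.
  have := h 1 0; rewrite /pencil !scaler0 !addr0 expr1n !scale1r scale0r addr0.
  by [].
exists m, (map_mx (@mpolyC n R) M).
by rewrite HA AE map_mxM map_trmx.
Qed.

(** The homogeneous coordinates [(1, X_1, ..., X_n)]: affine polynomials are
    linear in them and polynomials of degree at most two are quadratic forms. *)
Definition hcoord n : 'cV[{mpoly R[n]}]_n.+1 :=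
  \col_a (if unlift ord0 a is Some i then 'X_i else 1).

Lemma mnm_split n (m : 'X_{1..n}) : m != 0%MM -> exists i m', m = (m' + U_(i))%MM.
Proof.
move=> m0; have [i mi] : exists i, m i != 0%N.
  apply/existsP; apply: contraNT m0; rewrite negb_exists => /forallP h.
  by apply/eqP/mnmP => i; rewrite mnm0E; apply/eqP; have := h i; rewrite negbK.
by exists i, (m - U_(i))%MM; rewrite submK // lep1mP.
Qed.

Lemma monomial_hcoord1 n (m : 'X_{1..n}) : (mdeg m <= 1)%N ->
  exists a, 'X_[m] = hcoord n a 0.
Proof.
have [-> _|] := eqVneq m 0%MM; first by exists ord0; rewrite mxE unlift_none mpolyX0.
move=> /mnm_split [i [m' ->]]; rewrite mdegD mdeg1 addn1 ltnS leqn0 mdeg_eq0 => /eqP ->.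
by exists (lift ord0 i); rewrite mxE liftK add0m.
Qed.

Lemma monomial_hcoord2 n (m : 'X_{1..n}) : (mdeg m <= 2)%N ->
  exists a b, 'X_[m] = hcoord n a 0 * hcoord n b 0.
Proof.
have [-> _|] := eqVneq m 0%MM.
  by exists ord0, ord0; rewrite mxE unlift_none mpolyX0 mulr1.
move=> /mnm_split [i [m' ->]]; rewrite mdegD mdeg1 addn1 ltnS => /monomial_hcoord1[a ha].
by exists a, (lift ord0 i); rewrite mpolyXD ha [hcoord n (lift _ _) 0]mxE liftK.
Qed.

Lemma affine_repr n (g : {mpoly R[n]}) : (msize g <= 2)%N ->
  exists c : 'cV[R]_n.+1, g = \sum_a c a 0 *: hcoord n a 0.
Proof.
move=> sg; rewrite (mpolyE g).
have : forall m, m \in msupp g -> (mdeg m <= 1)%N.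
  by move=> m /msize_mdeg_lt h; rewrite -ltnS (leq_trans h).
elim: (msupp g) => [|m r IH] hr.
  by exists 0; rewrite big_nil big1 // => a _; rewrite mxE scale0r.
have [|c hc] := IH; first by move=> m' h'; apply: hr; rewrite inE h' orbT.
have [a ha] := monomial_hcoord1 (hr m (mem_head _ _)).
exists (g@_m *: delta_mx a 0 + c); rewrite big_cons hc ha.
under [RHS]eq_bigr => b _.
  rewrite [(_ + _ : 'cV__) b 0]mxE [(_ *: _ : 'cV__) b 0]mxE [delta_mx a 0 b 0]mxE andbT scalerDl.
  over.
rewrite big_split /=; congr (_ + _).
rewrite (bigD1 a) //= eqxx mulr1 big1 ?addr0 // => b ba.
by rewrite (negbTE ba) mulr0 scale0r.
Qed.

Definition quad_at_hcoord n (A : 'M[R]_n.+1) : {mpoly R[n]} :=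
  ((hcoord n)^T *m map_mx (@mpolyC n R) A *m hcoord n) 0 0.

Lemma quad_at_hcoordD n (A B : 'M[R]_n.+1) :
  quad_at_hcoord (A + B) = quad_at_hcoord A + quad_at_hcoord B.
Proof. by rewrite /quad_at_hcoord map_mxD mulmxDr mulmxDl mxE. Qed.

Lemma quad_at_hcoordZ n c (A : 'M[R]_n.+1) :
  quad_at_hcoord (c *: A) = c *: quad_at_hcoord A.
Proof.
by rewrite /quad_at_hcoord map_mxZ -scalemxAr -scalemxAl mxE mul_mpolyC.
Qed.

Lemma quad_at_hcoord_delta n a b :
  quad_at_hcoord (delta_mx a b) = hcoord n a 0 * hcoord n b 0.
Proof.
rewrite /quad_at_hcoord map_delta_mx.
have -> : (hcoord n)^T *m delta_mx a b = hcoord n a 0 *: delta_mx 0 b.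
  apply/rowP => j; rewrite !mxE (bigD1 a) //= big1 ?addr0 => [|k ka].
    by rewrite !mxE eqxx.
  by rewrite !mxE (negbTE ka) mulr0.
by rewrite -scalemxAl -rowE !mxE.
Qed.

Lemma quadratic_repr n (g : {mpoly R[n]}) : (msize g <= 3)%N ->
  exists A : 'M[R]_n.+1, A^T = A /\ g = quad_at_hcoord A.
Proof.
move=> sg; rewrite (mpolyE g).
have : forall m, m \in msupp g -> (mdeg m <= 2)%N.
  by move=> m /msize_mdeg_lt h; rewrite -ltnS (leq_trans h).
elim: (msupp g) => [|m r IH] hr.
  exists 0; rewrite trmx0 big_nil; split=> //.
  by rewrite -(scale0r (0 : 'M_n.+1)) quad_at_hcoordZ scale0r.
have [|A [sA hA]] := IH; first by move=> m' h'; apply: hr; rewrite inE h' orbT.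
have [a [b hab]] := monomial_hcoord2 (hr m (mem_head _ _)).
exists ((g@_m / 2) *: (delta_mx a b + delta_mx b a) + A); split.
  by rewrite raddfD /= linearZ /= raddfD /= !trmx_delta sA [X in _ *: X]addrC.
rewrite big_cons hA hab quad_at_hcoordD quad_at_hcoordZ quad_at_hcoordD.
rewrite !quad_at_hcoord_delta [hcoord n b 0 * _]mulrC .
by rewrite scalerDr -scalerDl -splitr.
Qed.

Lemma quad_at_hcoord_mul n m (M N : 'M[R]_(m, n.+1)) :
  quad_at_hcoord (M^T *m N) =
  \sum_k (map_mx (@mpolyC n R) M *m hcoord n) k 0 * (map_mx (@mpolyC n R) N *m hcoord n) k 0.
Proof.
rewrite /quad_at_hcoord map_mxM -map_trmx mulmxA -trmx_mul -mulmxA mxE.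
by apply: eq_bigr => k _; rewrite [in LHS]mxE.
Qed.

Lemma quad_at_hcoord_tr n (A : 'M[R]_n.+1) : quad_at_hcoord A^T = quad_at_hcoord A.
Proof.
rewrite /quad_at_hcoord -map_trmx.
set X := map_mx _ A; set w := hcoord n.
have -> : w^T *m X^T *m w = (w^T *m X *m w)^T by rewrite !trmx_mul trmxK mulmxA.
by rewrite mxE.
Qed.

Lemma meval_quad_at_hcoord n (A : 'M[R]_n.+1) (x : 'I_n -> R) :
  (quad_at_hcoord A).@[x] = quad A (\col_a (if unlift ord0 a is Some i then x i else 1)).
Proof.
rewrite /quad_at_hcoord mxE raddf_sum quad_sum exchange_big; apply: eq_bigr => j _.
rewrite [((hcoord n)^T *m _) 0 j]mxE mulr_suml raddf_sum; apply: eq_bigr => i _ /=.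
rewrite !mxE !mevalM mevalC.
by case: unliftP => *; case: unliftP => *; rewrite ?mevalXU ?meval1.
Qed.

(** Writing the entries as quadratic forms [A], [B], [C] in the homogeneous
    coordinates, the hypothesis is nonnegativity of the pencil at vectors whose
    first coordinate is nonzero, and these are dense.  The two columns of the
    factor are [M] and [N] applied to the homogeneous coordinates. *)
Lemma sos_quadratic_matrix2 n (P : 'M[{mpoly R[n]}]_2) :
  P^T = P -> (forall i j, (msize (P i j) <= 3)%N) ->
  (forall x s t, 0 <= s ^+ 2 * (P ord0 ord0).@[x] + 2 * s * t * (P ord0 ord_max).@[x]
                      + t ^+ 2 * (P ord_max ord_max).@[x]) ->
  sos_matrix P.
Proof.
move=> sP dP pP.
have [A [sA hA]] := quadratic_repr (dP ord0 ord0).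
have [B [sB hB]] := quadratic_repr (dP ord0 ord_max).
have [C [sC hC]] := quadratic_repr (dP ord_max ord_max).
have pQ s t : psd_mx (pencil A B C s t).
  have key (y : 'cV[R]_n.+1) : y ord0 0 != 0 -> 0 <= quad (pencil A B C s t) y.
    move=> y0; pose x i := y (lift ord0 i) 0 / y ord0 0.
    have -> : y = y ord0 0 *: (\col_a (if unlift ord0 a is Some i then x i else 1)).
      apply/colP => a; rewrite !mxE; case: unliftP => [i ->|->]; last by rewrite mulr1.
      by rewrite /x mulrC divfK.
    rewrite quad_scale mulr_ge0 ?sqr_ge0 // quad_pencil -!meval_quad_at_hcoord -hA -hB -hC.
    exact: pP.
  move=> y; have [y0|] := eqVneq (y ord0 0) 0; last exact: key.
  pose e0 : 'cV[R]_n.+1 := delta_mx ord0 0.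
  apply: (@quadratic_ge0_punctured _ _ (2 * (e0^T *m pencil A B C s t *m y) 0 0)
            (quad (pencil A B C s t) e0)) => e en0.
  have ye : (y + e *: e0) ord0 0 != 0 by rewrite !mxE y0 !eqxx mulr1 add0r.
  have := key _ ye.
  rewrite quad_addZ ?pencil_tr //; lra.
have [m [M [N h]]] := psd_pencil_sos sA sB sC pQ.
have hAM : A = M^T *m M.
  by have := h 1 0; rewrite /pencil expr1n mulr0 expr0n !scale0r !addr0 !scale1r.
have hCN : C = N^T *m N.
  by have := h 0 1; rewrite /pencil expr1n !mulr0 expr0n mul0r !scale0r !add0r !scale1r.
have hBM : 2 *: B = M^T *m N + N^T *m M.
  have tD : (M + N)^T = M^T + N^T by apply/matrixP => i j; rewrite !mxE.
  have := h 1 1; rewrite /pencil expr1n !mulr1 !scale1r tD mulmxDl !mulmxDr.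
  rewrite -hAM -hCN => E; apply: (addIr C); apply: (addrI A).
  by rewrite addrA E !addrA.
pose V : 'M[{mpoly R[n]}]_(m, 2) := row_mx (map_mx (@mpolyC n R) M *m hcoord n)
                                      (map_mx (@mpolyC n R) N *m hcoord n).
have V0 k : V k ord0 = (map_mx (@mpolyC n R) M *m hcoord n) k 0.
  by rewrite -(row_mxEl _ (map_mx (@mpolyC n R) N *m hcoord n)); congr (V k _); apply: val_inj.
have V1 k : V k ord_max = (map_mx (@mpolyC n R) N *m hcoord n) k 0.
  by rewrite -(row_mxEr (map_mx (@mpolyC n R) M *m hcoord n)); congr (V k _); apply: val_inj.
have P01 : P ord0 ord_max = \sum_k V k ord0 * V k ord_max.
  have h2 : 2 *: P ord0 ord_max = 2 *: (\sum_k V k ord0 * V k ord_max).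
    rewrite hB -quad_at_hcoordZ hBM quad_at_hcoordD -[N^T *m M]trmxK quad_at_hcoord_tr.
    rewrite trmx_mul trmxK scaler_nat mulr2n quad_at_hcoord_mul.
    by congr (_ + _); apply: eq_bigr => k _; rewrite V0 V1.
  by apply: (scalerI _ h2); rewrite pnatr_eq0.
exists m, V; apply/matrixP => i j; rewrite mxE.
have ord2 (k : 'I_2) : k = ord0 \/ k = ord_max.
  by case: k => [[|[|]]] // ?; [left|right]; apply: val_inj.
case: (ord2 i) => ->; case: (ord2 j) => ->.
- by rewrite hA hAM quad_at_hcoord_mul; apply: eq_bigr => k _; rewrite [in RHS]mxE !V0.
- by rewrite P01; apply: eq_bigr => k _; rewrite [in RHS]mxE.
- by rewrite -sP mxE P01; apply: eq_bigr => k _; rewrite [in RHS]mxE mulrC.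
- by rewrite hC hCN quad_at_hcoord_mul; apply: eq_bigr => k _; rewrite [in RHS]mxE !V1.
Qed.

Lemma sos_convex_bivariate_quartic (p : {mpoly R[2]}) :
  (msize p <= 5)%N -> convex_poly p -> sos_convex_poly p.
Proof.
move=> sp /convex_polyP cp; apply: sos_quadratic_matrix2; first exact: hessian_tr.
  move=> i j; apply: leq_trans (msize_hessian p i j) _.
  by move: sp; case: (msize p) => [|[|]].
move=> x s t; have := cp x (fun i => if i == ord0 then s else t).
rewrite /hessian_form !big_ord_recl !big_ord0 /=.
have -> : lift ord0 ord0 = ord_max :> 'I_2 by apply: val_inj.
have -> : hessian p ord_max ord0 = hessian p ord0 ord_max by rewrite -{1}hessian_tr mxE.
lra.
Qed.

End Positive.

(** * Two polynomial matrices without a Gram factorization *)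

Section SosReal.
Variable R : realType.

Definition affine3 (f : R -> R -> R -> R) : Prop := exists c : nat -> R,
  forall x y z, f x y z = c 0%N + c 1%N * x + c 2%N * y + c 3%N * z.

Definition quadratic2 (f : R -> R -> R) : Prop := exists c : nat -> R,
  forall x y, f x y = c 0%N + c 1%N * x + c 2%N * y
                      + c 3%N * x ^+ 2 + c 4%N * (x * y) + c 5%N * y ^+ 2.

Lemma sum_sqr_eq0 (I : finType) (F : I -> R) :
  \sum_k F k ^+ 2 = 0 -> forall k, F k = 0.
Proof.
move/eqP; rewrite psumr_eq0 => [/allP h k|k _]; last exact: sqr_ge0.
by have := h k (mem_index_enum k); rewrite sqrf_eq0 => /eqP.
Qed.

(** The right-hand side vanishes at [(1, 0)] and [(-1, 0)], hence so does every
    [f k].  On the lines [x = 1] and [x = -1] this leaves [(c2 + c4 s) y + c5 y^2]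
    with [s = x], whose squares sum to [60 y^4]; as the squares of [c5] already
    sum to 60, the coefficients [c2] and [c4] on [y] and [x y] vanish.  What is
    left of [f k] is a combination of [1 - x^2] and [y^2]. *)
Lemma sextic_gram_even m (f : 'I_m -> R -> R -> R) :
  (forall k, quadratic2 (f k)) ->
  (forall x y, \sum_k f k x y ^+ 2 =
     2 * ((x ^+ 2 - 1) ^+ 2 + 6 * y ^+ 2 * (x ^+ 2 - 1) + 30 * y ^+ 4)) ->
  forall k, f k (-1) 1 = f k 1 1 /\ f k 1 (-1) = f k 1 1.
Proof.
move=> /choice[c fE] E.
have root s k : s ^+ 2 = 1 -> f k s 0 = 0.
  by move=> s1; apply: (@sum_sqr_eq0 _ (fun k => f k s 0)); rewrite E s1; ring.
(* the half sum over [y = 1] and [y = -1] on [x = s] is [(c2 + c4 s)^2 + c5^2],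
   and a fourth difference in [y] on [x = 0] isolates [c5^2] *)
have lin s k : s ^+ 2 = 1 -> c k 2%N + c k 4%N * s = 0.
  move=> s1; apply: (@sum_sqr_eq0 _ (fun k => c k 2%N + c k 4%N * s)).
  transitivity (\sum_k (2^-1 * f k s 1 ^+ 2 + 2^-1 * f k s (-1) ^+ 2
    + (- 24^-1) * f k 0 2 ^+ 2 + (- 24^-1) * f k 0 (-2) ^+ 2
    + 6^-1 * f k 0 1 ^+ 2 + 6^-1 * f k 0 (-1) ^+ 2 + (- 4^-1) * f k 0 0 ^+ 2)).
    apply: eq_bigr => j _; have := root s j s1; rewrite !fE s1 => h.
    have -> : c j 0%N = - c j 1%N * s - c j 3%N by move: h; lra.
    by field.
  by rewrite !big_split /= -!mulr_sumr !E s1; field.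
have N1 : (-1 : R) ^+ 2 = 1 by rewrite sqrrN expr1n.
move=> k; have h1 := root 1 k (expr1n _ _); have h2 := root (-1) k N1.
have h3 := lin 1 k (expr1n _ _); have h4 := lin (-1) k N1.
by move: h1 h2 h3 h4; rewrite !fE; split; lra.
Qed.

(** Both factors would be even in [x], while the off-diagonal entry is odd. *)
Lemma sextic_hessian_not_gram m (f g : 'I_m -> R -> R -> R) :
  (forall k, quadratic2 (f k)) -> (forall k, quadratic2 (g k)) ->
  (forall x y, \sum_k f k x y ^+ 2 =
     2 * ((y ^+ 2 - 1) ^+ 2 + 6 * x ^+ 2 * (y ^+ 2 - 1) + 30 * x ^+ 4)) ->
  (forall x y, \sum_k g k x y ^+ 2 =
     2 * ((x ^+ 2 - 1) ^+ 2 + 6 * y ^+ 2 * (x ^+ 2 - 1) + 30 * y ^+ 4)) ->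
  (forall x y, \sum_k f k x y * g k x y = 8 * x * y * (x ^+ 2 + y ^+ 2 - 1)) ->
  False.
Proof.
move=> qf qg Ef Eg Efg.
have hg := sextic_gram_even qg Eg.
have hf := @sextic_gram_even m (fun k x y => f k y x) _ (fun x y => Ef y x).
have {}hf k : f k (-1) 1 = f k 1 1.
  have [|_ ->] // := hf _ k => j.
  have [c hc] := qf j; exists (fun i => nth 0 [:: c 0; c 2; c 1; c 5; c 4; c 3]%N i) => x y /=.
  by rewrite hc; ring.
have : \sum_k f k (-1) 1 * g k (-1) 1 = \sum_k f k 1 1 * g k 1 1.
  by apply: eq_bigr => k _; rewrite hf; have [-> _] := hg k.
rewrite !Efg; lra.
Qed.

(** Write [l_x] for the vector over [k] of the coefficients of [f k] on [x],
    with [l_0] for the constants, [r] for those of [g] and [c] for those of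
    [h].  The last diagonal entry has no constant term and the first none in
    [y^2], which kills [c_0] and [l_y].  Then [|l_0|^2 = |c_x|^2 = <l_0, c_x>]
    forces [l_0 = c_x], and similarly [r_0 = - c_y].  The remaining mixed
    terms give [<l_x, c_z> = <r_y, c_z> = 9], while [l_x], [r_y] and [c_z]
    have square norm 12 and [l_x] is orthogonal to [r_y].  This contradicts
    Bessel's inequality: [c_z - 3/4 (l_x + r_y)] would have square norm
    [12 - 27 + 27/2 < 0]. *)
Lemma quartic_hessian_not_gram m (f g h : 'I_m -> R -> R -> R -> R) :
  (forall k, affine3 (f k)) -> (forall k, affine3 (g k)) -> (forall k, affine3 (h k)) ->
  (forall x y z, \sum_k f k x y z * f k x y z = 6 * (2 * x ^+ 2 + z ^+ 2 + z + 1)) ->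
  (forall x y z, \sum_k g k x y z * g k x y z = 6 * (2 * y ^+ 2 + z ^+ 2 - z + 1)) ->
  (forall x y z, \sum_k h k x y z * h k x y z = 6 * (2 * z ^+ 2 + x ^+ 2 + y ^+ 2)) ->
  (forall x y z, \sum_k f k x y z * g k x y z = 0) ->
  (forall x y z, \sum_k f k x y z * h k x y z = 6 * x * (2 * z + 1)) ->
  (forall x y z, \sum_k g k x y z * h k x y z = 6 * y * (2 * z - 1)) ->
  False.
Proof.
move=> /choice[l fE] /choice[r gE] /choice[c hE] Eff Egg Ehh Efg Efh Egh.
have h0 k : c k 0%N = 0.
  have -> : c k 0%N = h k 0 0 0 by rewrite hE; ring.
  apply: (@sum_sqr_eq0 _ (fun k => h k 0 0 0)).
  by under eq_bigr => j _ do rewrite expr2; rewrite Ehh; ring.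
have l2 k : l k 2%N = 0.
  apply: (@sum_sqr_eq0 _ (fun k => l k 2%N)).
  transitivity (\sum_k (2^-1 * (f k 0 1 0 * f k 0 1 0) + 2^-1 * (f k 0 (-1) 0 * f k 0 (-1) 0)
     + (-1) * (f k 0 0 0 * f k 0 0 0))).
    by apply: eq_bigr => j _; rewrite !fE; field.
  by rewrite !big_split /= -!mulr_sumr !Eff; field.
have l0 k : l k 0%N - c k 1%N = 0.
  apply: (@sum_sqr_eq0 _ (fun k => l k 0%N - c k 1%N)).
  transitivity (\sum_k (1 * (f k 0 0 0 * f k 0 0 0) + 1 * (h k 1 0 0 * h k 1 0 0)
     + (-1) * (f k 1 0 0 * h k 1 0 0) + 1 * (f k (-1) 0 0 * h k (-1) 0 0))).
    by apply: eq_bigr => j _; rewrite !fE !hE h0; ring.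
  by rewrite !big_split /= -!mulr_sumr !(Eff, Ehh, Efh); ring.
have r0 k : r k 0%N + c k 2%N = 0.
  apply: (@sum_sqr_eq0 _ (fun k => r k 0%N + c k 2%N)).
  transitivity (\sum_k (1 * (g k 0 0 0 * g k 0 0 0) + 1 * (h k 0 1 0 * h k 0 1 0)
     + 1 * (g k 0 1 0 * h k 0 1 0) + (-1) * (g k 0 (-1) 0 * h k 0 (-1) 0))).
    by apply: eq_bigr => j _; rewrite !gE !hE h0; ring.
  by rewrite !big_split /= -!mulr_sumr !(Egg, Ehh, Egh); ring.
have : 0 <= \sum_k (c k 3%N - 3 / 4 * (l k 1%N + r k 2%N)) ^+ 2.
  by apply: sumr_ge0 => k _; exact: sqr_ge0.
(* every inner product in the expansion of the square is a combination of
   values of the Gram entries at points with coordinates in [{-1, 0, 1}] *)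
have -> : \sum_k (c k 3%N - 3 / 4 * (l k 1%N + r k 2%N)) ^+ 2 =
  \sum_k (1 * (h k 0 0 1 * h k 0 0 1)
   + (9 / 32) * (f k 1 0 0 * f k 1 0 0) + (9 / 32) * (f k (-1) 0 0 * f k (-1) 0 0)
   + (- (9 / 16)) * (f k 0 0 0 * f k 0 0 0)
   + (9 / 32) * (g k 0 1 0 * g k 0 1 0) + (9 / 32) * (g k 0 (-1) 0 * g k 0 (-1) 0)
   + (- (9 / 16)) * (g k 0 0 0 * g k 0 0 0)
   + (9 / 32) * (f k 1 1 0 * g k 1 1 0) + (9 / 32) * (f k (-1) (-1) 0 * g k (-1) (-1) 0)
   + (- (9 / 32)) * (f k 1 (-1) 0 * g k 1 (-1) 0)
   + (- (9 / 32)) * (f k (-1) 1 0 * g k (-1) 1 0)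
   + (- (3 / 8)) * (f k 1 0 1 * h k 1 0 1) + (- (3 / 8)) * (f k (-1) 0 (-1) * h k (-1) 0 (-1))
   + (3 / 8) * (f k 1 0 (-1) * h k 1 0 (-1)) + (3 / 8) * (f k (-1) 0 1 * h k (-1) 0 1)
   + (3 / 8) * (f k 0 0 1 * f k 0 0 1) + (- (3 / 8)) * (f k 0 0 (-1) * f k 0 0 (-1))
   + (- (3 / 8)) * (g k 0 1 1 * h k 0 1 1) + (- (3 / 8)) * (g k 0 (-1) (-1) * h k 0 (-1) (-1))
   + (3 / 8) * (g k 0 1 (-1) * h k 0 1 (-1)) + (3 / 8) * (g k 0 (-1) 1 * h k 0 (-1) 1)
   + (- (3 / 8)) * (g k 0 0 1 * g k 0 0 1) + (3 / 8) * (g k 0 0 (-1) * g k 0 0 (-1))).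
  apply: eq_bigr => k _; rewrite !fE !gE !hE h0 l2.
  have -> : l k 0%N = c k 1%N by apply/eqP; rewrite -subr_eq0 l0.
  have -> : r k 0%N = - c k 2%N by apply/eqP; rewrite -addr_eq0 r0.
  by field.
rewrite !big_split /= -!mulr_sumr !(Eff, Egg, Ehh, Efg, Efh, Egh); lra.
Qed.

End SosReal.

(** * Reduction of sos-convexity to coefficients *)

Section Coefficients.
Variable R : realType.

(** For the largest leading monomial [M] of the [f k], the coefficient of the
    sum at [2 M] is a nonzero sum of squares. *)
Lemma msize_sos n m (f : 'I_m -> {mpoly R[n]}) d :
  (msize (\sum_k f k ^+ 2) <= d.*2.+1)%N -> forall k, (msize (f k) <= d.+1)%N.
Proof.
move=> hs k; rewrite leqNgt; apply/negP => hk.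
pose k0 := [arg max_(k' > k) mlead (f k')]%O.
have k0max k' : (mlead (f k') <= mlead (f k0))%O.
  by rewrite /k0; case: Order.TotalTheory.arg_maxP => //= i _ hi; exact: hi.
have fk0 : f k != 0 by apply: contraTneq hk => ->; rewrite msize0.
have dk0 : (d < mdeg (mlead (f k0)))%N.
  apply: leq_trans (lemc_mdeg (k0max k)).
  by move: hk; rewrite -mlead_deg.
have f00 : f k0 != 0.
  by apply: contraTneq dk0 => ->; rewrite mlead0 mdeg0.
have coef : (\sum_k f k ^+ 2)@_(mlead (f k0) + mlead (f k0)) =
            \sum_k ((f k)@_(mlead (f k0))) ^+ 2.
  by rewrite raddf_sum; apply: eq_bigr => i _ /=; rewrite expr2 mleadcMW // expr2.
have : (mlead (f k0) + mlead (f k0))%MM \in msupp (\sum_k f k ^+ 2).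
  rewrite mcoeff_msupp coef gt_eqF // (bigD1 k0) //= ltr_wpDr //.
    by apply: sumr_ge0 => i _; exact: sqr_ge0.
  by rewrite exprn_even_gt0 //= mleadc_eq0.
move/msize_mdeg_lt; rewrite mdegD addnn => h.
by have := leq_trans h hs; rewrite ltnS leq_double leqNgt dk0.
Qed.

Lemma sum_delta n (i : 'I_n) (F : 'I_n -> R) : \sum_a (a == i)%:R * F a = F i.
Proof.
rewrite (bigD1 i) //= eqxx mul1r big1 ?addr0 // => a ai.
by rewrite (negbTE ai) mul0r.
Qed.

(** Recovers the entries of the Hessian from the form, whose closed expression is
    easier to compute. *)
Lemma hessian_form_two_coords n (p : {mpoly R[n]}) (x : 'I_n -> R) i j s t :
  hessian_form p x (fun l => s * (l == i)%:R + t * (l == j)%:R) =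
  s ^+ 2 * (hessian p i i).@[x] + 2 * s * t * (hessian p i j).@[x]
  + t ^+ 2 * (hessian p j j).@[x].
Proof.
have sym : hessian p j i = hessian p i j by rewrite -{1}hessian_tr mxE.
pose F a b := (hessian p a b).@[x].
have inner a : \sum_b (s * (b == i)%:R + t * (b == j)%:R) * F a b = s * F a i + t * F a j.
  rewrite -(sum_delta i (F a)) -(sum_delta j (F a)) !mulr_sumr -big_split.
  by apply: eq_bigr => b _ /=; ring.
transitivity (\sum_a (s * (a == i)%:R + t * (a == j)%:R) * (s * F a i + t * F a j)).
  rewrite /hessian_form; apply: eq_bigr => a _; rewrite -inner mulr_sumr.
  by apply: eq_bigr => b _; rewrite mulrA.
transitivity (s * (s * F i i + t * F i j) + t * (s * F j i + t * F j j)).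
  rewrite -(sum_delta i (fun a => s * F a i + t * F a j)).
  rewrite -(sum_delta j (fun a => s * F a i + t * F a j)) !mulr_sumr -big_split.
  by apply: eq_bigr => b _ /=; ring.
rewrite /F sym; ring.
Qed.

Lemma hessian_form_line n (p : {mpoly R[n]}) x v :
  hessian_form p x v = ((line p x v)^`()^`()).[0].
Proof.
by rewrite deriv2_line; congr hessian_form; apply/funext => i; rewrite mul0r addr0.
Qed.

Lemma meval_affine3 n (g : {mpoly R[n]}) i j k : (msize g <= 2)%N ->
  affine3 (fun x y z => g.@[fun l => x * (l == i)%:R + y * (l == j)%:R + z * (l == k)%:R]).
Proof.
move=> /affine_repr [c hc].
pose cs := [:: c ord0 0; c (lift ord0 i) 0; c (lift ord0 j) 0; c (lift ord0 k) 0].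
exists (fun e => nth 0 cs e).
move=> x y z /=; rewrite hc raddf_sum big_ord_recl /= mevalZ mxE unlift_none meval1 mulr1.
under eq_bigr => l _ do rewrite mevalZ mxE liftK mevalXU.
rewrite -!addrA; congr (_ + _).
rewrite -(sum_delta i (fun l => c (lift ord0 l) 0)) -(sum_delta j (fun l => c (lift ord0 l) 0)).
rewrite -(sum_delta k (fun l => c (lift ord0 l) 0)) !mulr_suml -!big_split.
by apply: eq_bigr => l _ /=; ring.
Qed.

(** The values on a coordinate plane are those of a quadratic form at
    [e0 + x ei + y ej], expanded by polarization. *)
Lemma meval_quadratic2 n (g : {mpoly R[n]}) i j : (msize g <= 3)%N ->
  quadratic2 (fun x y => g.@[fun l => x * (l == i)%:R + y * (l == j)%:R]).
Proof.
move=> /quadratic_repr [A [sA hA]].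
pose e0 : 'cV[R]_n.+1 := delta_mx ord0 0.
pose ei : 'cV[R]_n.+1 := delta_mx (lift ord0 i) 0.
pose ej : 'cV[R]_n.+1 := delta_mx (lift ord0 j) 0.
pose b (u v : 'cV[R]_n.+1) := (u^T *m A *m v) 0 0.
pose cs := [:: quad A e0; 2 * b ei e0; 2 * b ej e0; quad A ei; 2 * b ej ei; quad A ej].
exists (fun e => nth 0 cs e).
move=> x y /=; rewrite hA meval_quad_at_hcoord.
have -> : (\col_a (if unlift ord0 a is Some l then x * (l == i)%:R + y * (l == j)%:R else 1)) =
   (e0 + x *: ei) + y *: ej :> 'cV[R]_n.+1.
  apply/colP => a; rewrite !mxE !andbT; case: unliftP => [l ->|->] /=.
    by rewrite !(inj_eq lift_inj) add0r.
  by rewrite !mulr0 !addr0.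
rewrite !quad_addZ // mulmxDr -scalemxAr [(_ + _ : 'M_1) 0 0]mxE.
rewrite [(_ *: _ : 'M_1) 0 0]mxE -/(b _ _) -/(b _ _) -/(b _ _).
ring.
Qed.

Lemma msize_leD n (p q : {mpoly R[n]}) d :
  (msize p <= d)%N -> (msize q <= d)%N -> (msize (p + q) <= d)%N.
Proof. by move=> hp hq; apply: leq_trans (msizeD_le _ _) _; rewrite geq_max hp. Qed.

Lemma msize_leM n (p q : {mpoly R[n]}) a b :
  (msize p <= a.+1)%N -> (msize q <= b.+1)%N -> (msize (p * q) <= (a + b).+1)%N.
Proof.
move=> hp hq; have [->|p0] := eqVneq p 0; first by rewrite mul0r msize0.
have [->|q0] := eqVneq q 0; first by rewrite mulr0 msize0.
rewrite msizeM //; apply: (@leq_trans (a.+1 + b.+1).-1); last by rewrite addnS.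
by rewrite -!subn1 leq_sub2r // leq_add.
Qed.

End Coefficients.

(** * Two convex polynomials that are not sos-convex *)

Section Jets.
Variable R : realType.
(** The jets at [0] are named so that the rules below rewrite them without
    unfolding products and powers of polynomials. *)
Definition jet0 (q : {poly R}) : R := q.[0].
Definition jet1 (q : {poly R}) : R := (q^`()).[0].
Definition jet2 (q : {poly R}) : R := (q^`()^`()).[0].

Lemma jetD q r : (jet0 (q + r) = jet0 q + jet0 r) * (jet1 (q + r) = jet1 q + jet1 r)
  * (jet2 (q + r) = jet2 q + jet2 r).
Proof. by rewrite /jet0 /jet1 /jet2 !derivD !hornerD. Qed.

Lemma jetN q : (jet0 (- q) = - jet0 q) * (jet1 (- q) = - jet1 q) * (jet2 (- q) = - jet2 q).
Proof. by rewrite /jet0 /jet1 /jet2 !derivN !hornerN. Qed.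

Lemma jetMn q k : (jet0 (q *+ k) = jet0 q *+ k) * (jet1 (q *+ k) = jet1 q *+ k)
  * (jet2 (q *+ k) = jet2 q *+ k).
Proof. by rewrite /jet0 /jet1 /jet2 !derivMn !hornerMn. Qed.

Lemma jetM q r : (jet0 (q * r) = jet0 q * jet0 r)
  * (jet1 (q * r) = jet1 q * jet0 r + jet0 q * jet1 r)
  * (jet2 (q * r) = jet2 q * jet0 r + 2 * (jet1 q * jet1 r) + jet0 q * jet2 r).
Proof.
rewrite /jet0 /jet1 /jet2 derivM derivD !derivM !hornerD !hornerM; split=> //; ring.
Qed.

Lemma jetX q k : (jet0 (q ^+ k) = jet0 q ^+ k)
  * (jet1 (q ^+ k) = k%:R * jet0 q ^+ k.-1 * jet1 q)
  * (jet2 (q ^+ k) = k%:R * jet0 q ^+ k.-1 * jet2 q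
                     + (k * k.-1)%:R * jet0 q ^+ k.-2 * jet1 q ^+ 2).
Proof.
have h0 m : jet0 (q ^+ m) = jet0 q ^+ m by rewrite /jet0 horner_exp.
have h1 m : jet1 (q ^+ m) = m%:R * jet0 q ^+ m.-1 * jet1 q.
  by rewrite /jet1 /jet0 deriv_exp hornerMn hornerM horner_exp -mulr_natl; ring.
split; first by split.
rewrite /jet2 deriv_exp -/(jet1 _) jetMn jetM h0 h1 natrM -mulr_natl.
by rewrite -/(jet2 q) {1 2}/jet1 -/(jet1 q) -/(jet2 q) /jet0 -/(jet1 q); ring.
Qed.

Lemma jet_line n (x v : 'I_n -> R) i (a := line 'X_i x v) :
  (jet0 a = x i) * (jet1 a = v i) * (jet2 a = 0).
Proof.
rewrite /a /jet0 /jet1 /jet2 lineX derivD derivC derivZ derivX add0r alg_polyC derivC.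
by rewrite hornerD !hornerC hornerZ hornerX mulr0 addr0 ?horner0.
Qed.

Definition sextic n (i j : 'I_n) : {mpoly R[n]} :=
  'X_i ^+ 6 *+ 2 + 'X_j ^+ 6 *+ 2 + 'X_i ^+ 4 * 'X_j ^+ 2 + 'X_i ^+ 2 * 'X_j ^+ 4
  - ('X_i ^+ 2 + 'X_j ^+ 2) ^+ 2 + 'X_i ^+ 2 + 'X_j ^+ 2.

Definition quartic n (i j k : 'I_n) : {mpoly R[n]} :=
  'X_i ^+ 4 + 'X_j ^+ 4 + 'X_k ^+ 4 + ('X_i ^+ 2 + 'X_j ^+ 2) * 'X_k ^+ 2 *+ 3
  + ('X_i ^+ 2 - 'X_j ^+ 2) * 'X_k *+ 3 + ('X_i ^+ 2 + 'X_j ^+ 2) *+ 3.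

Lemma sextic_hessian n (i j : 'I_n) x v :
  hessian_form (sextic i j) x v =
  2 * (v i ^+ 2 * ((x j ^+ 2 - 1) ^+ 2 + 6 * x i ^+ 2 * (x j ^+ 2 - 1) + 30 * x i ^+ 4)
     + 8 * v i * v j * x i * x j * (x i ^+ 2 + x j ^+ 2 - 1)
     + v j ^+ 2 * ((x i ^+ 2 - 1) ^+ 2 + 6 * x j ^+ 2 * (x i ^+ 2 - 1) + 30 * x j ^+ 4)).
Proof.
rewrite hessian_form_line -/(jet2 _) /sextic /line.
rewrite !(rmorphD, rmorphN, rmorphM, rmorphXn, rmorphMn) /= -!/(line _ x v).
rewrite !(jetD, jetN, jetX, jetM, jet_line) /=; ring.
Qed.

Lemma quartic_hessian n (i j k : 'I_n) x v :
  hessian_form (quartic i j k) x v =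
  6 * (v i ^+ 2 * (2 * x i ^+ 2 + x k ^+ 2 + x k + 1)
     + v j ^+ 2 * (2 * x j ^+ 2 + x k ^+ 2 - x k + 1)
     + v k ^+ 2 * (2 * x k ^+ 2 + x i ^+ 2 + x j ^+ 2)
     + 2 * v i * v k * x i * (2 * x k + 1) + 2 * v j * v k * x j * (2 * x k - 1)).
Proof.
rewrite hessian_form_line -/(jet2 _) /quartic /line.
rewrite !(rmorphD, rmorphN, rmorphM, rmorphXn, rmorphMn) /= -!/(line _ x v).
rewrite !(jetD, jetN, jetX, jetM, jet_line) /=; ring.
Qed.
End Jets.

Section Counterexamples.
Variable R : realType.

(** Half the form is [u^2 P + 8 a b t u w + w^2 Q] with
    [t = a^2 + b^2 - 1], [P = t^2 + 4 t a^2 + 25 a^4] and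
    [Q = t^2 + 4 t b^2 + 25 b^4].  As [P >= 4 |t| a^2] and [Q >= 4 |t| b^2], it
    dominates [4 |t| (|a u| - |b w|)^2]. *)
Lemma sextic_convex n (i j : 'I_n) : convex_poly (sextic R i j).
Proof.
apply/convex_polyP => x v; rewrite sextic_hessian mulr_ge0 //.
move: (x i) (x j) (v i) (v j) => a b u w.
have [t tE] : {t | t = a ^+ 2 + b ^+ 2 - 1} by exists (a ^+ 2 + b ^+ 2 - 1).
have [t0|t0] := leP 0 t.
  rewrite [leRHS](_ : _ = 4 * t * (a * u + b * w) ^+ 2
      + u ^+ 2 * (t ^+ 2 + 25 * (a ^+ 2) ^+ 2) + w ^+ 2 * (t ^+ 2 + 25 * (b ^+ 2) ^+ 2)).
    by rewrite !(sqr_ge0, addr_ge0, mulr_ge0).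
  by rewrite tE; ring.
rewrite [leRHS](_ : _ = 4 * (- t) * (a * u - b * w) ^+ 2
    + u ^+ 2 * ((t + 4 * a ^+ 2) ^+ 2 + 9 * (a ^+ 2) ^+ 2)
    + w ^+ 2 * ((t + 4 * b ^+ 2) ^+ 2 + 9 * (b ^+ 2) ^+ 2)).
  have t1 : 0 <= - t by rewrite oppr_ge0 ltW.
  by rewrite !(sqr_ge0, addr_ge0, mulr_ge0).
by rewrite tE; ring.
Qed.

Lemma binary_form_ge0 (a b c u w : R) : 0 < a -> b ^+ 2 <= a * c ->
  0 <= a * u ^+ 2 + 2 * b * u * w + c * w ^+ 2.
Proof.
move=> a0 bc; rewrite -(pmulr_rge0 _ a0).
rewrite [leRHS](_ : _ = (a * u + b * w) ^+ 2 + (a * c - b ^+ 2) * w ^+ 2); last by ring.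
apply: addr_ge0; first exact: sqr_ge0.
by apply: mulr_ge0; rewrite ?sqr_ge0 ?subr_ge0.
Qed.

(** A sixth of the Hessian form of [quartic] couples [w], the component along
    the third variable, with each of the other two components separately.  It
    is a sum of two such binary forms once the term [2 z^2 w^2] is distributed
    between them; the second one is the first with [z] replaced by [-z].  The
    three alternatives are the shares [th] that the distribution needs. *)
Lemma quartic_half_ge0 (a z u w th : R) :
  (th = z ^+ 2 + z /\ 0 <= z ^+ 2 + z) \/ (th = 2 * z ^+ 2 /\ 0 <= z)
    \/ (th = 0 /\ z ^+ 2 + z <= 0) ->
  0 <= (2 * a ^+ 2 + z ^+ 2 + z + 1) * u ^+ 2 + 2 * (a * (2 * z + 1)) * u * w
       + (th + a ^+ 2) * w ^+ 2.
Proof.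
move=> hth; apply: binary_form_ge0; first by nra.
have a2 : 0 <= a ^+ 2 by rewrite sqr_ge0.
rewrite exprMn -subr_ge0.
case: hth => [[-> z0]|[[-> z0]|[-> z0]]].
- rewrite [leRHS](_ : _ = 2 * (a ^+ 2 - (z ^+ 2 + z) / 4) ^+ 2
     + 7 / 8 * (z ^+ 2 + z) ^+ 2 + (z ^+ 2 + z)); last by field.
  have := sqr_ge0 (a ^+ 2 - (z ^+ 2 + z) / 4); have := sqr_ge0 (z ^+ 2 + z); lra.
- rewrite [leRHS](_ : _ = 2 * (a ^+ 2 - 3 / 4 * z) ^+ 2 + 7 / 8 * z ^+ 2
     + (a * z) ^+ 2 + 2 * (z ^+ 2) ^+ 2 + 2 * z * z ^+ 2); last by field.
  have := mulr_ge0 z0 (sqr_ge0 z).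
  have := sqr_ge0 (a ^+ 2 - 3 / 4 * z); have := sqr_ge0 z; have := sqr_ge0 (a * z).
  have := sqr_ge0 (z ^+ 2); lra.
- rewrite [leRHS](_ : _ = 2 * (a ^+ 2) ^+ 2 + 3 * (a ^+ 2 * - (z ^+ 2 + z))); last by ring.
  have : 0 <= a ^+ 2 * - (z ^+ 2 + z) by rewrite mulr_ge0 // oppr_ge0.
  have := sqr_ge0 (a ^+ 2); lra.
Qed.

(** The shares of [2 z^2] are [z^2 + z] and [z^2 - z] when both are nonnegative,
    that is for [|z| >= 1]; otherwise the component with [z^2 + z] or [z^2 - z]
    negative needs nothing and the other one receives everything. *)
Lemma quartic_convex n (i j k : 'I_n) : convex_poly (quartic R i j k).
Proof.
apply/convex_polyP => x v; rewrite quartic_hessian mulr_ge0 //.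
move: (x i) (x j) (x k) (v i) (v j) (v k) => a b z u w s.
suff [th1 [th2 [th12 [h1 h2]]]] : exists th1 th2, th1 + th2 = 2 * z ^+ 2 /\
    (0 <= (2 * a ^+ 2 + z ^+ 2 + z + 1) * u ^+ 2 + 2 * (a * (2 * z + 1)) * u * s
       + (th1 + a ^+ 2) * s ^+ 2 /\
     0 <= (2 * b ^+ 2 + (- z) ^+ 2 + - z + 1) * (- w) ^+ 2
       + 2 * (b * (2 * - z + 1)) * (- w) * s
       + (th2 + b ^+ 2) * s ^+ 2).
  move: h1 h2; have -> : th2 = 2 * z ^+ 2 - th1 by rewrite -th12 addrC addKr.
  lra.
have [z1|z1] := leP 1 (z ^+ 2).
  exists (z ^+ 2 + z), ((- z) ^+ 2 - z); split; first by ring.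
  by split; apply: quartic_half_ge0; left; split=> //; nra.
have [z0|z0] := leP 0 z.
  exists (2 * z ^+ 2), 0; split; first by ring.
  split; apply: quartic_half_ge0; first by right; left.
  by right; right; split=> //; nra.
exists 0, (2 * (- z) ^+ 2); split; first by ring.
split; apply: quartic_half_ge0; last by right; left; split=> //; lra.
by right; right; split=> //; nra.
Qed.

Lemma msize_mpolyXn n (i : 'I_n) k : (msize ('X_i ^+ k : {mpoly R[n]}) <= k.+1)%N.
Proof. by rewrite mpolyXn msizeX mdegMn mdeg1 mul1n. Qed.

Lemma msize_leMn n (p : {mpoly R[n]}) d k : (msize p <= d)%N -> (msize (p *+ k) <= d)%N.
Proof.
move=> hp; elim: k => [|k IH]; first by rewrite mulr0n msize0.
by rewrite mulrS; exact: msize_leD.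
Qed.

Lemma msize_sextic n (i j : 'I_n) : (msize (sextic R i j) <= 7)%N.
Proof.
have X (l : 'I_n) k : (k <= 6)%N -> (msize ('X_l ^+ k : {mpoly R[n]}) <= 7)%N.
  by move=> k6; apply: leq_trans (msize_mpolyXn l k) _.
have S : (msize ('X_i ^+ 2 + 'X_j ^+ 2 : {mpoly R[n]}) <= 3)%N.
  by apply: msize_leD; exact: msize_mpolyXn.
have M k l : (k + l <= 6)%N -> (msize ('X_i ^+ k * 'X_j ^+ l : {mpoly R[n]}) <= 7)%N.
  by move=> h; apply: leq_trans (msize_leM (msize_mpolyXn i k) (msize_mpolyXn j l)) _.
rewrite /sextic.
apply: msize_leD; last exact: X.
apply: msize_leD; last exact: X.
apply: msize_leD; last first.
  by rewrite msizeN expr2; apply: leq_trans (msize_leM S S) _.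
apply: msize_leD; last exact: M.
apply: msize_leD; last exact: M.
by apply: msize_leD; apply: msize_leMn; exact: X.
Qed.

Lemma msize_quartic n (i j k : 'I_n) : (msize (quartic R i j k) <= 5)%N.
Proof.
have X (l : 'I_n) e : (e <= 4)%N -> (msize ('X_l ^+ e : {mpoly R[n]}) <= 5)%N.
  by move=> e4; apply: leq_trans (msize_mpolyXn l e) _.
have S : (msize ('X_i ^+ 2 + 'X_j ^+ 2 : {mpoly R[n]}) <= 3)%N.
  by apply: msize_leD; exact: msize_mpolyXn.
have D : (msize ('X_i ^+ 2 - 'X_j ^+ 2 : {mpoly R[n]}) <= 3)%N.
  by apply: msize_leD; rewrite ?msizeN; exact: msize_mpolyXn.
rewrite /quartic.
apply: msize_leD; last by apply: msize_leMn; exact: leq_trans S _.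
apply: msize_leD; last first.
  apply: msize_leMn; apply: leq_trans (_ : 4 <= 5)%N => //.
  exact: (msize_leM D (msize_mpolyXn k 1)).
apply: msize_leD; last by apply: msize_leMn; exact: (msize_leM S (msize_mpolyXn k 2)).
by apply: msize_leD; [apply: msize_leD|]; exact: X.
Qed.

Lemma sos_hessian_gram n (p : {mpoly R[n]}) m (V : 'M[{mpoly R[n]}]_(m, n)) i j x :
  hessian p = V^T *m V ->
  \sum_k (V k i).@[x] * (V k j).@[x] = (hessian p i j).@[x].
Proof.
move=> ->; rewrite mxE raddf_sum; apply: eq_bigr => k _ /=.
by rewrite mxE mevalM.
Qed.

Lemma msize_sos_hessian n (p : {mpoly R[n]}) m (V : 'M[{mpoly R[n]}]_(m, n)) d :
  hessian p = V^T *m V -> (msize p <= d.*2.+3)%N -> forall k i, (msize (V k i) <= d.+1)%N.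
Proof.
move=> HV dp k i; apply: (@msize_sos _ _ _ (fun k => V k i)).
have -> : \sum_k V k i ^+ 2 = hessian p i i.
  by rewrite HV mxE; apply: eq_bigr => l _; rewrite mxE expr2.
apply: leq_trans (msize_hessian p i i) _.
by move: dp; case: (msize p) => [|[|]].
Qed.

(** On the plane of the variables [i] and [j], two columns of [V] would be
    quadratic polynomials with a forbidden Gram matrix. *)
Lemma sextic_not_sos_convex n (i j : 'I_n) : i != j -> ~ sos_convex_poly (sextic R i j).
Proof.
move=> ij [m [V HV]].
have dV := msize_sos_hessian HV (msize_sextic i j : (_ <= 2.*2.+3)%N).
pose pt (x y : R) (l : 'I_n) := x * (l == i)%:R + y * (l == j)%:R.
have pti x y : pt x y i = x by rewrite /pt eqxx (negbTE ij) mulr1 mulr0 addr0.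
have ptj x y : pt x y j = y by rewrite /pt eqxx eq_sym (negbTE ij) mulr1 mulr0 add0r.
have form x y s t := hessian_form_two_coords (sextic R i j) (pt x y) i j s t.
have vi (s t : R) : s * (i == i)%:R + t * (i == j)%:R = s by exact: pti.
have vj (s t : R) : s * (j == i)%:R + t * (j == j)%:R = t by exact: ptj.
apply: (@sextic_hessian_not_gram _ m (fun k x y => (V k i).@[pt x y])
  (fun k x y => (V k j).@[pt x y])).
- by move=> k; exact: meval_quadratic2.
- by move=> k; exact: meval_quadratic2.
- move=> x y; under eq_bigr => k _ do rewrite expr2.
  rewrite (sos_hessian_gram _ _ _ HV).
  have := form x y 1 0; rewrite sextic_hessian vi vj pti ptj; lra.
- move=> x y; under eq_bigr => k _ do rewrite expr2.
  rewrite (sos_hessian_gram _ _ _ HV).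
  have := form x y 0 1; rewrite sextic_hessian vi vj pti ptj; lra.
- move=> x y; rewrite (sos_hessian_gram _ _ _ HV).
  have := form x y 1 1; have := form x y 1 (-1); rewrite !sextic_hessian !vi !vj pti ptj; lra.
Qed.

Lemma quartic_not_sos_convex n (i j k : 'I_n) : i != j -> i != k -> j != k ->
  ~ sos_convex_poly (quartic R i j k).
Proof.
move=> ij ik jk [m [V HV]].
have dV := msize_sos_hessian HV (msize_quartic i j k : (_ <= 1.*2.+3)%N).
pose pt (x y z : R) (l : 'I_n) := x * (l == i)%:R + y * (l == j)%:R + z * (l == k)%:R.
have pti x y z : pt x y z i = x.
  by rewrite /pt eqxx (negbTE ij) (negbTE ik) mulr1 !mulr0 !addr0.
have ptj x y z : pt x y z j = y.
  by rewrite /pt eqxx eq_sym (negbTE ij) (negbTE jk) mulr1 !mulr0 addr0 add0r.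
have ptk x y z : pt x y z k = z.
  by rewrite /pt eqxx !(eq_sym k) (negbTE ik) (negbTE jk) mulr1 !mulr0 !add0r.
have ne : ((i == j) = false) * ((j == i) = false) * ((i == k) = false) *
          ((k == i) = false) * ((j == k) = false) * ((k == j) = false).
  by rewrite !(eq_sym k) (eq_sym j i) (negbTE ij) (negbTE ik) (negbTE jk).
have form x y z a b s t := hessian_form_two_coords (quartic R i j k) (pt x y z) a b s t.
apply: (@quartic_hessian_not_gram _ m (fun e x y z => (V e i).@[pt x y z])
  (fun e x y z => (V e j).@[pt x y z]) (fun e x y z => (V e k).@[pt x y z])).
- by move=> e; exact: meval_affine3.
- by move=> e; exact: meval_affine3.
- by move=> e; exact: meval_affine3.
- move=> x y z; rewrite (sos_hessian_gram _ _ _ HV); have := form x y z i j 1 0.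
  by rewrite quartic_hessian /= !(pti, ptj, ptk, eqxx, ne) /=; lra.
- move=> x y z; rewrite (sos_hessian_gram _ _ _ HV); have := form x y z i j 0 1.
  by rewrite quartic_hessian /= !(pti, ptj, ptk, eqxx, ne) /=; lra.
- move=> x y z; rewrite (sos_hessian_gram _ _ _ HV); have := form x y z i k 0 1.
  by rewrite quartic_hessian /= !(pti, ptj, ptk, eqxx, ne) /=; lra.
- move=> x y z; rewrite (sos_hessian_gram _ _ _ HV).
  have := form x y z i j 1 1; have := form x y z i j 1 (-1).
  by rewrite !quartic_hessian /= !(pti, ptj, ptk, eqxx, ne) /=; lra.
- move=> x y z; rewrite (sos_hessian_gram _ _ _ HV).
  have := form x y z i k 1 1; have := form x y z i k 1 (-1).
  by rewrite !quartic_hessian /= !(pti, ptj, ptk, eqxx, ne) /=; lra.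
- move=> x y z; rewrite (sos_hessian_gram _ _ _ HV).
  have := form x y z j k 1 1; have := form x y z j k 1 (-1).
  by rewrite !quartic_hessian /= !(pti, ptj, ptk, eqxx, ne) /=; lra.
Qed.

End Counterexamples.

(** * The characterization *)

Theorem theorem3p8 (R : realType) (n d : nat) (hn : (1 <= n)%N)
    (hd : (2 <= d)%N) (hd_even : ~~ odd d) :
  sos_convex_polys R n d = convex_polys R n d <->
  n = 1%N \/ d = 2%N \/ (n, d) = (2%N, 4%N).
Proof.
split=> [E|H].
  have sos (p : {mpoly R[n]}) : (msize p <= d.+1)%N -> convex_poly p -> sos_convex_poly p.
    move=> dp cp; have : convex_polys R n d p by [].
    by rewrite -E => -[].
  have [->|n1] := eqVneq n 1%N; first by left.
  have [->|d2] := eqVneq d 2%N; first by right; left.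
  right; right.
  have n2 : (2 <= n)%N by rewrite ltn_neqAle eq_sym n1.
  have d4 : (4 <= d)%N.
    by case: d hd d2 hd_even {E sos} => [|[|[|[|]]]].
  pose i0 : 'I_n := Ordinal (ltn_trans (ltnSn 0) n2); pose i1 : 'I_n := Ordinal n2.
  have [n3|n3] := leqP 3 n.
    pose i2 : 'I_n := Ordinal n3.
    case: (@quartic_not_sos_convex R n i0 i1 i2) => //; apply: sos.
      exact: leq_trans (msize_quartic R _ _ _) _.
    exact: quartic_convex.
  have -> : n = 2%N by apply/eqP; rewrite eqn_leq n2 -ltnS n3.
  have [d6|d6] := leqP 6 d.
    case: (@sextic_not_sos_convex R n i0 i1) => //; apply: sos.
      exact: leq_trans (msize_sextic R _ _) _.
    exact: sextic_convex.
  by congr (_, _); case: d d4 d6 hd_even {hd d2 E sos} => [|[|[|[|[|[|]]]]]].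
rewrite /sos_convex_polys /convex_polys; apply/seteqP; split=> p /= [dp cp]; split=> //.
  exact: sos_convex_convex.
case: H => [n1|[d2|[n2 d4]]].
- by subst n; exact: sos_convex_univariate.
- by subst d; exact: sos_convex_quadratic.
- by subst n d; exact: sos_convex_bivariate_quartic.
Qed.
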